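(* Let $\mathcal G$ and $\mathcal H$ be Lie groupoids and let $X$ be a biprincipal diffeological $(\mathcal G,\mathcal H)$-bibundle. Then $X$ is a biprincipal bibundle in the Lie sense. That is, a diffeological Morita equivalence between two Lie groupoids via diffeological bibundles is a Lie Morita equivalence via a bibundle in the Lie groupoid sense.
   Context: Diffeology. A parametrisation of a set $X$ is a map $p\colon U_p\to X$ from an open subset $U_p$ of some $\mathbb{R}^n$, $n\ge 0$. A diffeology on $X$ is a set of parametrisations, called plots, containing all constant parametrisations, such that a parametrisation that restricts to a plot on each member of an open cover of its domain is a plot, and such that $p\circ f$ is a plot for every plot $p$ and every smooth map $f\colon V\to U_p$ from an open subset $V$ of some $\mathbb{R}^m$. A map $F\colon X\to Y$ of diffeological spaces is smooth if $F\circ p$ is a plot of $Y$ for every plot $p$ of $X$; a diffeomorphism is a smooth bijection with smooth inverse. A subset of $X$ carries the plots of $X$ with image in it; products carry the parametrisations whose components are plots; fibre products $X\times_{f,g}Y=\{(x,y):f(x)=g(y)\}$ carry the subset diffeology of the product. A smooth surjection $F\colon X\to Y$ is a subduction if for every plot $p$ of $Y$ there are an open cover $\{U_\alpha\}$ of $U_p$ and plots $q_\alpha\colon U_\alpha\to X$ with $p|_{U_\alpha}=F\circ q_\alpha$. Smooth manifolds are regarded as diffeological spaces whose plots are the smooth parametrisations; a diffeological space ''is a manifold'' if its diffeology arises in this way from a (necessarily unique) smooth manifold structure. Groupoids. A diffeological groupoid $\mathcal G=(\mathcal G_1\rightrightarrows\mathcal G_0)$ is a small groupoid whose sets of objects $\mathcal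 G_0$ and arrows $\mathcal G_1$ are diffeological spaces such that the source $s$, target $t$, unit $x\mapsto u_x$, multiplication ($gh$ defined when $s(g)=t(h)$) and inversion are smooth. A Lie groupoid is a diffeological groupoid with $\mathcal G_0$ a (Hausdorff, second-countable) smooth manifold, $\mathcal G_1$ a smooth manifold not required to be Hausdorff or second-countable, and $s,t$ submersions. Bibundles. A left action of $\mathcal G$ on a diffeological space $X$ with smooth anchor $l\colon X\to\mathcal G_0$ is a smooth map $\mathcal G_1\times_{s,l}X\to X$, $(g,x)\mapsto gx$, with $l(gx)=t(g)$, $g'(gx)=(g'g)x$, $u_{l(x)}x=x$. A right action of $\mathcal H$ with smooth anchor $r\colon X\to\mathcal H_0$ is a smooth map $X\times_{r,t}\mathcal H_1\to X$ with $r(xh)=s(h)$, $(xh)h'=x(hh')$, $xu_{r(x)}=x$. A diffeological $(\mathcal G,\mathcal H)$-bibundle is a diffeological space $X$ with a left $\mathcal G$-action with anchor $l_X$ and a right $\mathcal H$-action with anchor $r_X$ such that $l_X$ is $\mathcal H$-invariant, $r_X$ is $\mathcal G$-invariant and the actions commute. It is right principal if $l_X\colon X\to\mathcal G_0$ is a subduction and $X\times_{r_X,t}\mathcal H_1\to X\times_{l_X,l_X}X$, $(x,h)\mapsto(x,xh)$, is a diffeomorphism; left principal if $r_X\colon X\to\mathcal H_0$ is a subduction and $\mathcal G_1\times_{s,l_X}X\to X\times_{r_X,r_X}X$, $(g,x)\mapsto(gx,x)$, is a diffeomorphism; biprincipal if both. A diffeological Morita equivalence via bibundles is a biprincipal diffeological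 bibundle. For Lie groupoids $\mathcal G,\mathcal H$, such a bibundle is biprincipal in the Lie sense if $X$ is a smooth manifold (as for arrow spaces of Lie groupoids, not required to be Hausdorff or second-countable), $l_X$ and $r_X$ are surjective submersions, the actions are smooth maps of manifolds, and the two maps $(x,h)\mapsto(x,xh)$ and $(g,x)\mapsto(gx,x)$ above are diffeomorphisms of manifolds. A Lie Morita equivalence via bibundles is such a bibundle. *)

(* Defs.v *)
From HB Require Import structures.
From mathcomp Require Import all_boot all_order all_algebra.
From mathcomp Require Import all_classical all_reals all_analysis.
Import numFieldNormedType.Exports.

Set Implicit Arguments.
Unset Strict Implicit.
Unset Printing Implicit Defensive.

Local Open Scope classical_set_scope.
Local Open Scope ring_scope.

Section Smooth.
Variable R : realType.

(* Continuous partial derivatives of all orders <= k on U, which is meant to be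
   open; the values of f outside U are then irrelevant. *)
Fixpoint Ck_on m n (k : nat) (U : set 'rV[R]_m) (f : 'rV[R]_m -> 'rV[R]_n)
    : Prop :=
  (forall x, U x -> {for x, continuous f}) /\
  (if k is k'.+1 then
     forall i : 'I_m,
       (forall x, U x -> derivable f x (delta_mx 0 i)) /\
       Ck_on k' U ('D_(delta_mx 0 i) f)
   else True).

Definition smooth_on m n (U : set 'rV[R]_m) (f : 'rV[R]_m -> 'rV[R]_n) : Prop :=
  forall k, Ck_on k U f.

End Smooth.

Section Diffeology.
Variable R : realType.

(* A parametrisation U -> X is given by U together with a total map on R^n of
   which only the restriction to U matters ([plot_ext]).  Every map U -> X
   arises in this way unless X is empty, in which case the only parametrisations
   are those with empty domain, and these are plots of any diffeology. *)
Record diffspace := DiffSpace {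
  dcarrier :> Type;
  plot : forall n, set 'rV[R]_n -> ('rV[R]_n -> dcarrier) -> Prop;
  plot_open : forall n (U : set 'rV[R]_n) p, plot U p -> open U;
  plot_ext : forall n (U : set 'rV[R]_n) p q,
    (forall x, U x -> p x = q x) -> plot U p -> plot U q;
  plot_const : forall n (U : set 'rV[R]_n) x, open U -> plot U (fun=> x);
  plot_local : forall n (U : set 'rV[R]_n) p (C : set (set 'rV[R]_n)),
    (forall V, C V -> open V) -> U = \bigcup_(V in C) V ->
    (forall V, C V -> plot V p) -> plot U p;
  plot_comp : forall m n (U : set 'rV[R]_n) p (V : set 'rV[R]_m) f,
    plot U p -> open V -> smooth_on V f -> (forall y, V y -> U (f y)) ->
    plot V (p \o f)
}.

Definition dsmooth (X Y : diffspace) (F : X -> Y) : Prop :=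
  forall n (U : set 'rV[R]_n) p, plot U p -> plot U (F \o p).

Definition ddiffeo (X Y : diffspace) (F : X -> Y) : Prop :=
  dsmooth F /\ exists G : Y -> X, [/\ dsmooth G, cancel F G & cancel G F].

Definition subduction (X Y : diffspace) (F : X -> Y) : Prop :=
  [/\ dsmooth F, (forall y, exists x, F x = y) &
    forall n (U : set 'rV[R]_n) (p : 'rV[R]_n -> Y), plot U p ->
      exists C : set (set 'rV[R]_n),
        [/\ (forall V, C V -> open V), U = \bigcup_(V in C) V &
          forall V, C V -> exists2 q : 'rV[R]_n -> X,
            plot V q & forall x, V x -> p x = F (q x)]].

Section ProdDiff.
Variables X Y : diffspace.

Definition prod_plot n (U : set 'rV[R]_n) (p : 'rV[R]_n -> X * Y) :=
  plot U (fst \o p) /\ plot U (snd \o p).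

Program Definition prod_diff : diffspace :=
  @DiffSpace (X * Y)%type prod_plot _ _ _ _ _.
Next Obligation. by move=> n U p [/plot_open]. Qed.
Next Obligation.
by move=> n U p q pq [h1 h2]; split;
  [move: h1|move: h2]; apply: plot_ext => x Ux /=; rewrite pq.
Qed.
Next Obligation. by move=> n U x oU; split; exact: plot_const. Qed.
Next Obligation.
by move=> n U p C oC UC h; split; apply: (plot_local oC UC) => V /h [].
Qed.
Next Obligation.
by move=> m n U p V f [h1 h2] oV sf fVU; split;
  [exact: (plot_comp h1)|exact: (plot_comp h2)].
Qed.

End ProdDiff.

Section SubDiff.
Variables (X : diffspace) (P : X -> Prop).

Definition sub_plot n (U : set 'rV[R]_n) (p : 'rV[R]_n -> {x : X | P x}) :=
  plot U (fun y => sval (p y)).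

Program Definition sub_diff : diffspace :=
  @DiffSpace {x : X | P x} sub_plot _ _ _ _ _.
Next Obligation. by move=> n U p; exact: plot_open. Qed.
Next Obligation.
by move=> n U p q pq; apply: plot_ext => x Ux /=; rewrite pq.
Qed.
Next Obligation. by move=> n U x oU; exact: plot_const. Qed.
Next Obligation. by move=> n U p C oC UC h; exact: (plot_local oC UC). Qed.
Next Obligation.
by move=> m n U p V f hp oV sf fVU; exact: (plot_comp hp oV sf fVU).
Qed.

End SubDiff.

Definition fibprod (X Y Z : diffspace) (f : X -> Z) (g : Y -> Z) : diffspace :=
  @sub_diff (prod_diff X Y) (fun xy => f xy.1 = g xy.2).

Definition fibpair (X Y Z : diffspace) (f : X -> Z) (g : Y -> Z) (x : X) (y : Y)
    (e : f x = g y) : fibprod f g :=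
  exist (fun xy : X * Y => f xy.1 = g xy.2) (x, y) e.

(* The total map on a fibre product given by a partially defined binary
   operation such as a multiplication or an action. *)
Definition fibfun (X Y Z : diffspace) (f : X -> Z) (g : Y -> Z) (W : Type)
    (op : forall x y, f x = g y -> W) (xy : fibprod f g) : W :=
  op (sval xy).1 (sval xy).2 (svalP xy).

End Diffeology.

Section Manifold.
Variable R : realType.

(* A chart on a subset [cdom] of M with values in R^n; [cmap] is relevant on
   [cdom] only, and [cinv] on the image of [cdom] only. *)
Record chart (n : nat) (M : Type) := Chart {
  cdom : set M;
  cmap : M -> 'rV[R]_n;
  cinv : 'rV[R]_n -> M;
  cdomK : forall x, cdom x -> cinv (cmap x) = x;
  cimg_open : open (cmap @` cdom)
}.

Definition chart_smooth m n (M N : Type) (c : chart m M) (d : chart n N)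
    (F : M -> N) : Prop :=
  let W := cmap c @` (cdom c `&` F @^-1` cdom d) in
  open W /\ smooth_on W (cmap d \o F \o cinv c).

(* Charts form a set on M without topology; the topology is the one for which
   the charts are homeomorphisms onto open subsets of R^n, see below. *)
Record atlas (n : nat) (M : Type) := Atlas {
  charts : set (chart n M);
  charts_cover : forall x, exists2 c, charts c & cdom c x;
  charts_compat : forall c d, charts c -> charts d -> chart_smooth c d id
}.

Definition atlas_space n M (A : atlas n M) : Type := M.

Definition atlas_open n M (A : atlas n M) (O : set (atlas_space A)) : Prop :=
  forall c, charts A c -> open (cmap c @` (cdom c `&` O)).

Section AtlasTopology.
Variables (n : nat) (M : Type) (A : atlas n M).

Let openT : atlas_open (A := A) setT.
Proof. by move=> c _; rewrite setIT; exact: cimg_open. Qed.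

Let openI : setI_closed (atlas_open (A := A)).
Proof.
move=> O1 O2 o1 o2 c Ac; rewrite (_ : _ @` _ =
  (cmap c @` (cdom c `&` O1)) `&` (cmap c @` (cdom c `&` O2))).
  by apply: openI; [exact: o1|exact: o2].
apply/seteqP; split=> [_ [x [cx [x1 x2]] <-]|_ [[x [cx x1] <-] [y [cy y2] yx]]].
  by split; exists x.
have xy : x = y by rewrite -(cdomK cx) -(cdomK cy) yx.
by exists x => //; split=> //; split=> //; rewrite xy.
Qed.

Let open_bigU (I : Type) (f : I -> set (atlas_space A)) :
  (forall i, atlas_open (f i)) -> atlas_open (\bigcup_i f i).
Proof.
move=> of_ c Ac; rewrite (_ : _ @` _ = \bigcup_i (cmap c @` (cdom c `&` f i))).
  by apply: bigcup_open => i _; exact: of_.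
apply/seteqP; split=> [_ [x [cx [i _ fix_]] <-]|_ [i _ [x [cx fix_] <-]]].
  by exists i => //; exists x.
by exists x => //; split=> //; exists i.
Qed.

HB.instance Definition _ := gen_eqMixin (atlas_space A).
HB.instance Definition _ := gen_choiceMixin (atlas_space A).
HB.instance Definition _ :=
  isOpenTopological.Build (atlas_space A) openT openI open_bigU.

End AtlasTopology.

Definition mfd_smooth m n (M N : Type) (A : atlas m M) (B : atlas n N)
    (F : M -> N) : Prop :=
  forall c d, charts A c -> charts B d -> chart_smooth c d F.

Definition mfd_diffeo m n (M N : Type) (A : atlas m M) (B : atlas n N)
    (F : M -> N) : Prop :=
  mfd_smooth A B F /\
  exists G : N -> M, [/\ mfd_smooth B A G, cancel F G & cancel G F].

Definition submersion m n (M N : Type) (A : atlas m M) (B : atlas n N)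
    (F : M -> N) : Prop :=
  mfd_smooth A B F /\
  forall x c d, charts A c -> charts B d -> cdom c x -> cdom d (F x) ->
    forall w, exists v, 'd (cmap d \o F \o cinv c) (cmap c x) v = w.

Definition smooth_param n (M : Type) (A : atlas n M)
    m (U : set 'rV[R]_m) (p : 'rV[R]_m -> M) : Prop :=
  open U /\ forall c, charts A c ->
    let W := U `&` p @^-1` cdom c in open W /\ smooth_on W (cmap c \o p).

(* X "is a manifold" iff this type is inhabited. *)
Record manifold_structure (X : diffspace R) := ManifoldStructure {
  mdim : nat;
  matlas :> atlas mdim X;
  mplots : forall m (U : set 'rV[R]_m) (p : 'rV[R]_m -> X),
    plot U p <-> smooth_param matlas U p
}.

End Manifold.

Section Groupoid.
Variable R : realType.

Record diff_groupoid := DiffGroupoid {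
  obj : diffspace R;
  arr : diffspace R;
  src : arr -> obj;
  tgt : arr -> obj;
  gunit : obj -> arr;
  gmul : forall g h : arr, src g = tgt h -> arr;
  ginv : arr -> arr;
  src_unit : forall x, src (gunit x) = x;
  tgt_unit : forall x, tgt (gunit x) = x;
  src_mul : forall g h (e : src g = tgt h), src (gmul e) = src h;
  tgt_mul : forall g h (e : src g = tgt h), tgt (gmul e) = tgt g;
  gmulA : forall g h k (e1 : src g = tgt h) (e2 : src h = tgt k)
    (e3 : src (gmul e1) = tgt k) (e4 : src g = tgt (gmul e2)),
    gmul e3 = gmul e4;
  gmul1g : forall g (e : src (gunit (tgt g)) = tgt g), gmul e = g;
  gmulg1 : forall g (e : src g = tgt (gunit (src g))), gmul e = g;
  src_inv : forall g, src (ginv g) = tgt g;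
  tgt_inv : forall g, tgt (ginv g) = src g;
  gmulVg : forall g (e : src (ginv g) = tgt g), gmul e = gunit (src g);
  gmulgV : forall g (e : src g = tgt (ginv g)), gmul e = gunit (tgt g);
  src_smooth : dsmooth src;
  tgt_smooth : dsmooth tgt;
  gunit_smooth : dsmooth gunit;
  gmul_smooth : @dsmooth R (fibprod src tgt) arr (fibfun gmul);
  ginv_smooth : dsmooth ginv
}.

Record lie_groupoid := LieGroupoid {
  lie_gpd :> diff_groupoid;
  obj_mfd : manifold_structure (obj lie_gpd);
  arr_mfd : manifold_structure (arr lie_gpd);
  obj_hausdorff : hausdorff_space (atlas_space obj_mfd);
  obj_second_countable : @second_countable (atlas_space obj_mfd);
  src_submersion : submersion arr_mfd obj_mfd (@src lie_gpd);
  tgt_submersion : submersion arr_mfd obj_mfd (@tgt lie_gpd)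
}.

Record left_action (G : diff_groupoid) (X : diffspace R) := LeftAction {
  lanchor : X -> obj G;
  lact : forall (g : arr G) (x : X), src g = lanchor x -> X;
  lanchor_smooth : dsmooth lanchor;
  lact_smooth : @dsmooth R (fibprod (@src G) lanchor) X (fibfun lact);
  lanchor_act : forall g x (e : src g = lanchor x), lanchor (lact e) = tgt g;
  lactA : forall g' g x (e1 : src g = lanchor x)
    (e2 : src g' = lanchor (lact e1)) (e3 : src g' = tgt g)
    (e4 : src (gmul e3) = lanchor x), lact e2 = lact e4;
  lact1 : forall x (e : src (gunit (lanchor x)) = lanchor x), lact e = x
}.

Record right_action (H : diff_groupoid) (X : diffspace R) := RightAction {
  ranchor : X -> obj H;
  ract : forall (x : X) (h : arr H), ranchor x = tgt h -> X;
  ranchor_smooth : dsmooth ranchor;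
  ract_smooth : @dsmooth R (fibprod ranchor (@tgt H)) X (fibfun ract);
  ranchor_act : forall x h (e : ranchor x = tgt h), ranchor (ract e) = src h;
  ractA : forall x h h' (e1 : ranchor x = tgt h)
    (e2 : ranchor (ract e1) = tgt h') (e3 : src h = tgt h')
    (e4 : ranchor x = tgt (gmul e3)), ract e2 = ract e4;
  ract1 : forall x (e : ranchor x = tgt (gunit (ranchor x))), ract e = x
}.

Record bibundle (G H : diff_groupoid) := Bibundle {
  bib :> diffspace R;
  bleft : left_action G bib;
  bright : right_action H bib;
  lanchor_inv : forall x h (e : ranchor bright x = tgt h),
    lanchor bleft (ract e) = lanchor bleft x;
  ranchor_inv : forall g x (e : src g = lanchor bleft x),
    ranchor bright (lact e) = ranchor bright x;
  lact_ract : forall g x h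
    (e1 : src g = lanchor bleft x) (e2 : ranchor bright (lact e1) = tgt h)
    (e3 : ranchor bright x = tgt h) (e4 : src g = lanchor bleft (ract e3)),
    ract e2 = lact e4
}.

Section Principal.
Variables (G H : diff_groupoid) (X : bibundle G H).

Definition anchl : X -> obj G := lanchor (bleft X).
Definition anchr : X -> obj H := ranchor (bright X).

(* G_1 x_{s,l} X and X x_{r,t} H_1 *)
Definition lact_dom : diffspace R := fibprod (@src G) anchl.
Definition ract_dom : diffspace R := fibprod anchr (@tgt H).

Definition lact_fun : lact_dom -> X := fibfun (@lact G X (bleft X)).
Definition ract_fun : ract_dom -> X := fibfun (@ract H X (bright X)).

(* (g, x) |-> (g x, x) and (x, h) |-> (x, x h) *)
Definition lact_pair (gx : lact_dom) : fibprod anchr anchr :=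
  fibpair (f := anchr) (g := anchr) (ranchor_inv (svalP gx)).
Definition ract_pair (xh : ract_dom) : fibprod anchl anchl :=
  fibpair (f := anchl) (g := anchl) (esym (lanchor_inv (svalP xh))).

Definition right_principal : Prop := subduction anchl /\ ddiffeo ract_pair.
Definition left_principal : Prop := subduction anchr /\ ddiffeo lact_pair.
Definition biprincipal : Prop := left_principal /\ right_principal.

End Principal.

(* The manifold structure of a fibre product is the one whose smooth
   parametrisations are those with smooth components, that is, the one inducing
   the diffeology of the fibre product; it is unique up to equivalence of
   atlases. *)
Definition lie_biprincipal (G H : lie_groupoid) (X : bibundle G H) : Prop :=
  exists (MX : manifold_structure X)
         (MGX : manifold_structure (lact_dom X))
         (MXH : manifold_structure (ract_dom X))
         (MXlX : manifold_structure (fibprod (@anchl G H X) (@anchl G H X)))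
         (MXrX : manifold_structure (fibprod (@anchr G H X) (@anchr G H X))),
    [/\ submersion MX (obj_mfd G) (@anchl G H X) /\
          (forall y, exists x, @anchl G H X x = y),
        submersion MX (obj_mfd H) (@anchr G H X) /\
          (forall y, exists x, @anchr G H X x = y),
        mfd_smooth MGX MX (@lact_fun G H X) /\
          mfd_smooth MXH MX (@ract_fun G H X),
        mfd_diffeo MXH MXlX (@ract_pair G H X) &
        mfd_diffeo MGX MXrX (@lact_pair G H X)].

End Groupoid.

(* Main.v *)
(* Right principality makes X a manifold: a local section sigma of l over an open
   U in G_0, given by the subduction l, identifies l^-1(U) with the fibre product
   of r sigma : U -> H_0 and t : H_1 -> H_0 by (u, h) |-> sigma(u) h, and a fibre
   product with a submersion is a manifold since, by the inverse function theorem,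
   submersions are projections in suitable charts.  Between manifolds a smooth
   map is a submersion as soon as plots lift locally along it through every point
   of its source; for l, a lift through x is got from an arbitrary one by acting
   with a lift of r sigma through the submersion t, and symmetrically for r.  The
   remaining manifolds are fibre products of anchors with s or t, transported
   along the two principality diffeomorphisms, and diffeologically smooth maps
   between manifolds are smooth. *)

Require Import Defs.
From mathcomp Require Import all_boot all_order all_algebra.
From mathcomp Require Import all_classical all_reals all_analysis.
From mathcomp Require Import lra ring.
Import Order.TTheory GRing.Theory Num.Theory.
Import numFieldNormedType.Exports.

Set Implicit Arguments.
Unset Strict Implicit.
Unset Printing Implicit Defensive.

Local Open Scope classical_set_scope.
Local Open Scope ring_scope.

(** * Differential calculus in coordinates *)

Section CkScalar.
Variables (R : realType) (m : nat).
Implicit Types (U : set 'rV[R]_m) (f g : 'rV[R]_m -> R).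

(** The scalar counterpart of [Ck_on]. Sums, products, inverses and determinants are handled here,
    and [Ck_onP] carries the results over to row vectors coordinate by coordinate. *)
Fixpoint Ck_fun (k : nat) U f : Prop :=
  (forall x, U x -> {for x, continuous f}) /\
  (if k is k'.+1 then
     forall i : 'I_m,
       (forall x, U x -> derivable f x (delta_mx 0 i)) /\
       Ck_fun k' U ('D_(delta_mx 0 i) f)
   else True).

Lemma open_near_eq (T : Type) U (f g : 'rV[R]_m -> T) x : open U ->
  (forall x, U x -> f x = g x) -> U x -> \forall y \near x, f y = g y.
Proof.
by move=> oU fg Ux; apply: filterS (open_nbhs_nbhs (conj oU Ux)) => y /fg.
Qed.

Lemma Ck_fun_ext k U f g : open U -> (forall x, U x -> f x = g x) ->
  Ck_fun k U f -> Ck_fun k U g.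
Proof.
move=> oU; elim: k f g => [|k IH] f g fg /= [cf df]; split.
- move=> x Ux; rewrite /prop_for /continuous_at -(fg x Ux).
  by apply: cvg_trans (cf x Ux); apply: near_eq_cvg (open_near_eq oU fg Ux).
- by [].
- move=> x Ux; rewrite /prop_for /continuous_at -(fg x Ux).
  by apply: cvg_trans (cf x Ux); apply: near_eq_cvg (open_near_eq oU fg Ux).
- move=> i; have [d1 d2] := df i; split.
    by move=> x Ux; apply: near_eq_derivable (d1 x Ux);
      exact: open_near_eq fg Ux.
  by apply: IH d2 => x Ux; apply: near_eq_derive; exact: open_near_eq fg Ux.
Qed.

Lemma Ck_fun_continuous k U f x : Ck_fun k U f -> U x -> {for x, continuous f}.
Proof. by case: k => [|k] [cf _]; exact: cf. Qed.

Lemma Ck_funW k U f : Ck_fun k.+1 U f -> Ck_fun k U f.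
Proof.
elim: k f => [|k IH] f [cf df]; split=> // i.
by have [d1 d2] := df i; split=> //; exact: IH.
Qed.

Lemma Ck_fun_sub k U (V : set 'rV[R]_m) f : V `<=` U -> Ck_fun k U f ->
  Ck_fun k V f.
Proof.
move=> VU; elim: k f => [|k IH] f [cf df]; split=> //.
- by move=> x /VU; exact: cf.
- by move=> x /VU; exact: cf.
- move=> i; have [d1 d2] := df i; split; last exact: IH.
  by move=> x /VU; exact: d1.
Qed.

Lemma Ck_fun_cst k U (a : R) : open U -> Ck_fun k U (fun=> a).
Proof.
move=> oU; elim: k a => [|k IH] a; split=> //; try by move=> x _;
  exact: cst_continuous.


move=> i; split; first by move=> x _; exact: derivable_cst.
by apply: Ck_fun_ext (IH 0) => // x _; rewrite derive_cst.
Qed.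

Lemma Ck_fun_coord k U j : open U -> Ck_fun k U (fun x => x 0 j).
Proof.
move=> oU.
have dx i x : is_derive x (delta_mx 0 i) (fun x : 'rV[R]_m => x 0 j)
  ((i == j)%:R).
  have dfx := differentiable_coord x 0 j.
  split; first exact: diff_derivable.
  have /(derive_mx (M := id)) : derivable id x (delta_mx 0 i) by
    exact: derivable_id.
  by rewrite derive_id => /matrixP/(_ 0 j); rewrite !mxE eqxx/= => <-;
    rewrite eq_sym.
case: k => [|k]; split=> //; try by move=> x _; exact: coord_continuous.
move=> i; split=> [x _|]; first exact: ex_derive.
by apply: Ck_fun_ext (Ck_fun_cst k (i == j)%:R oU) => // x _;
  rewrite (derive_val (is_derive := dx i x)).
Qed.

Lemma Ck_funD k U f g : open U -> Ck_fun k U f -> Ck_fun k U g ->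
  Ck_fun k U (fun x => f x + g x).
Proof.
move=> oU; elim: k f g => [|k IH] f g [cf df] [cg dg]; split=> //.
- by move=> x Ux; exact: (cvgD (cf x Ux) (cg x Ux)).
- by move=> x Ux; exact: (cvgD (cf x Ux) (cg x Ux)).
- move=> i; have [[f1 f2] [g1 g2]] := (df i, dg i); split=> [x Ux|].
    by apply: derivableD; [exact: f1|exact: g1].
  apply: Ck_fun_ext (IH _ _ f2 g2) => // x Ux.
  by rewrite -deriveD//; [exact: f1|exact: g1].
Qed.

Lemma Ck_funM k U f g : open U -> Ck_fun k U f -> Ck_fun k U g ->
  Ck_fun k U (fun x => f x * g x).
Proof.
move=> oU; elim: k f g => [|k IH] f g Cf Cg; have [[cf df] [cg dg]] := (Cf, Cg).
  by split=> // x Ux; exact: (cvgM (cf x Ux) (cg x Ux)).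
split=> [x Ux|i]; first by exact: (cvgM (cf x Ux) (cg x Ux)).
have [[f1 f2] [g1 g2]] := (df i, dg i); split=> [x Ux|].
  by apply: derivableM; [exact: f1|exact: g1].
have := Ck_funD oU (IH _ _ (Ck_funW Cf) g2) (IH _ _ (Ck_funW Cg) f2).
apply: Ck_fun_ext => // x Ux.
by rewrite (@deriveM _ _ f g)//; [exact: f1|exact: g1].
Qed.

Lemma Ck_funV k U f : open U -> (forall x, U x -> f x != 0) -> Ck_fun k U f ->
  Ck_fun k U (fun x => (f x)^-1).
Proof.
move=> oU f0; elim: k f f0 => [|k IH] f f0 Cf; have [cf df] := Cf.
  by split=> // x Ux; exact: (cvgV (f0 x Ux) (cf x Ux)).
split=> [x Ux|i]; first by exact: (cvgV (f0 x Ux) (cf x Ux)).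
have [f1 f2] := df i; split=> [x Ux|].
  by apply: derivableV; [exact: f0|exact: f1].
(* The derivative of 1/f is -(1/f)(1/f)f', so regularity of 1/f one order lower, given by the
   induction hypothesis, suffices. *)
have CV := IH _ f0 (Ck_funW Cf).
have := Ck_funM oU (Ck_funM oU (Ck_fun_cst k (-1) oU) (Ck_funM oU CV CV)) f2.
apply: Ck_fun_ext => // x Ux.
rewrite (@deriveV _ _ f)//; [|exact: f0|exact: f1].
by rewrite mulN1r -exprVn expr2.
Qed.

Lemma Ck_fun_sum k U (I : Type) (r : seq I) (P : pred I)
    (F : I -> 'rV[R]_m -> R) : open U ->
  (forall i, Ck_fun k U (F i)) ->
    Ck_fun k U (fun x => \sum_(i <- r | P i) F i x).
Proof.
move=> oU CF; elim: r => [|i r IH].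
  by apply: Ck_fun_ext (Ck_fun_cst k 0 oU) => // x _; rewrite big_nil.
case Pi: (P i).
  apply: Ck_fun_ext (Ck_funD oU (CF i) IH) => // x _.
  by rewrite [RHS]big_cons Pi.
by apply: Ck_fun_ext IH => // x _; rewrite [RHS]big_cons Pi.
Qed.

Lemma Ck_fun_prod k U (I : Type) (r : seq I) (P : pred I)
    (F : I -> 'rV[R]_m -> R) : open U ->
  (forall i, Ck_fun k U (F i)) ->
    Ck_fun k U (fun x => \prod_(i <- r | P i) F i x).
Proof.
move=> oU CF; elim: r => [|i r IH].
  by apply: Ck_fun_ext (Ck_fun_cst k 1 oU) => // x _; rewrite big_nil.
case Pi: (P i).
  apply: Ck_fun_ext (Ck_funM oU (CF i) IH) => // x _.
  by rewrite [RHS]big_cons Pi.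
by apply: Ck_fun_ext IH => // x _; rewrite [RHS]big_cons Pi.
Qed.

Lemma Ck_fun_det k U p (A : 'rV[R]_m -> 'M[R]_p) : open U ->
  (forall i j, Ck_fun k U (fun x => A x i j)) ->
    Ck_fun k U (fun x => \det (A x)).
Proof.
move=> oU CA; apply: Ck_fun_sum => // s; apply: Ck_funM => //.
  exact: Ck_fun_cst.
by apply: Ck_fun_prod.
Qed.

(** Cramer's rule: the entries of the inverse are cofactors divided by the determinant. This drives
    the regularity of the local inverse in the inverse function theorem. *)
Lemma Ck_fun_invmx k U p (A : 'rV[R]_m -> 'M[R]_p) i j : open U ->
  (forall i j, Ck_fun k U (fun x => A x i j)) ->
  (forall x, U x -> A x \in unitmx) -> Ck_fun k U (fun x => invmx (A x) i j).
Proof.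
move=> oU CA Au.
have CV : Ck_fun k U (fun x => (\det (A x))^-1).
  apply: Ck_funV => //; last exact: Ck_fun_det.
  by move=> x /Au; rewrite unitmxE unitfE.
have Cc : Ck_fun k U (fun x => cofactor (A x) j i).
  apply: Ck_funM => //; first exact: Ck_fun_cst.
  apply: Ck_fun_det => // a b.
  by apply: Ck_fun_ext (CA (lift j a) (lift i b)) => // x _; rewrite !mxE.
apply: Ck_fun_ext (Ck_funM oU CV Cc) => // x Ux.
by rewrite /invmx Au// !mxE.
Qed.

End CkScalar.

(** * Mean value estimates, strict differentiability and the chain rule for vector-valued maps *)

Section CkVector.
Variable R : realType.

Lemma continuous_rVP (T : topologicalType) n (f : T -> 'rV[R]_n) x :
  {for x, continuous f} <-> forall j, {for x, continuous (fun y => f y 0 j)}.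
Proof.
split=> [cf j|cf].
  apply: (@continuous_comp _ _ _ f (fun v : 'rV[R]_n => v 0 j)) => //.
  exact: coord_continuous.
apply/cvg_mx_entourageP => A entA.
apply: filter_forall => i; apply: filter_forall => j.
rewrite (ord1 i).
have := cf j => /cvg_app_entourageP/(_ A entA).
move=> h; suff : \forall t \near x, (f x 0 j, f t 0 j) \in A by [].
by apply: filterS h => y; rewrite inE.
Qed.

Lemma Ck_onP m n k (U : set 'rV[R]_m) (f : 'rV[R]_m -> 'rV[R]_n) : open U ->
  Ck_on k U f <-> forall j, Ck_fun k U (fun x => f x 0 j).
Proof.
move=> oU; elim: k f => [|k IH] f.
  split=> [[cf _] j|Cf]; (split; last by []) => x Ux.
    by have /continuous_rVP := cf x Ux; exact.
  by apply/continuous_rVP => j; have [cf _] := Cf j; exact: cf.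
have dE i j x : derivable f x (delta_mx 0 i) ->
    'D_(delta_mx 0 i) (fun x => f x 0 j) x = 'D_(delta_mx 0 i) f x 0 j.
  by move=> /derive_mx->; rewrite mxE.
split=> [[cf df] j|Cf].
  split=> [x Ux|i]; first by have /continuous_rVP := cf x Ux; exact.
  have [d1 d2] := df i; split=> [x Ux|].
    by have /derivable_mxP := d1 x Ux; exact.
  move/IH : d2 => /(_ j); apply: Ck_fun_ext => // x Ux.
  by rewrite dE//; exact: d1.
split=> [x Ux|i].
  by apply/continuous_rVP => j; exact: Ck_fun_continuous (Cf j) Ux.
have d1 x : U x -> derivable f x (delta_mx 0 i).
  move=> Ux; apply/derivable_mxP => a j; rewrite (ord1 a).
  by have [_ /(_ i)[+ _]] := Cf j; exact.
split=> //; apply/IH => j; have [_ /(_ i)[_]] := Cf j.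
by apply: Ck_fun_ext => // x Ux; rewrite dE//; exact: d1.
Qed.


(** The one-variable mean value theorem for t |-> f (t e + z). The two conditions on [t] say
    together that it lies between 0 and [s], whatever the sign of [s]. *)
Lemma MVT_dir n (f : 'rV[R]_n -> R) (z e : 'rV[R]_n) (s : R) :
  (forall t, `|t| <= `|s| -> 0 <= t * s -> derivable f (t *: e + z) e) ->
  exists2 t, `|t| <= `|s| /\ 0 <= t * s &
    f (s *: e + z) - f z = s * 'D_e f (t *: e + z).
Proof.
move=> df; pose phi (t : R) := f (t *: e + z).
have dphi (t : R) : `|t| <= `|s| -> 0 <= t * s ->
    is_derive t 1 phi ('D_e f (t *: e + z)).
  move=> ts ts0; have dt := df t ts ts0.
  have E : (fun h : R => h^-1 *: (phi (h *: 1 + t) - phi t)) =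
    (fun h : R => h^-1 *: (f (h *: e + (t *: e + z)) - f (t *: e + z))).
    by apply/funext => h; rewrite /phi [h *: 1]mulr1 scalerDl addrA.
  split; first by rewrite /derivable E; exact: dt.
  by rewrite /derive E.
have cphi (t : R) : `|t| <= `|s| -> 0 <= t * s -> {for t, continuous phi}.
  move=> ts ts0; have [+ _] := dphi t ts ts0.
  by move=> /derivable1_diffP; exact: differentiable_continuous.
have phi0 : phi 0 = f z by rewrite /phi scale0r add0r.
rewrite -phi0 -/(phi s).
have [s0|s0|<-] := ltgtP 0 s; last first.
- exists 0; first by rewrite mul0r lexx.
  by rewrite subrr mul0r.
- have H (t : R) : t \in `[s, 0] -> `|t| <= `|s| /\ 0 <= t * s.
    rewrite in_itv/= => /andP[st t0]; rewrite !ler0_norm ?lerN2//;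
      last exact: ltW.
    by rewrite mulr_le0// ltW.
  have [||c cs E] := @MVT R phi (fun t => 'D_e f (t *: e + z)) s 0 s0.
  + by move=> t /subset_itv_oo_cc /H[]; exact: dphi.
  + by apply: continuous_in_subspaceT => t; rewrite inE => /H[]; exact: cphi.
  exists c; first by apply: H; apply: subset_itv_oo_cc cs.
  by rewrite -opprB E sub0r mulrN opprK mulrC.
- have H (t : R) : t \in `[0, s] -> `|t| <= `|s| /\ 0 <= t * s.
    rewrite in_itv/= => /andP[t0 st]; rewrite !ger0_norm// ?(ltW s0)//.
    by rewrite mulr_ge0// ltW.
  have [||c cs E] := @MVT R phi (fun t => 'D_e f (t *: e + z)) 0 s s0.
  + by move=> t /subset_itv_oo_cc /H[]; exact: dphi.
  + by apply: continuous_in_subspaceT => t; rewrite inE => /H[]; exact: cphi.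
  exists c; first by apply: H; apply: subset_itv_oo_cc cs.
  by rewrite E subr0 mulrC.
Qed.

(* The sup-norm balls are boxes, so one can move inside them one coordinate at
   a time. *)
Lemma MVT_box n (f : 'rV[R]_n -> R) (x0 x y : 'rV[R]_n) (r : R) :
  (forall z i, ball x0 r z -> derivable f z (delta_mx 0 i)) ->
  ball x0 r x -> ball x0 r y ->
  exists xi : 'I_n -> 'rV[R]_n, (forall i, ball x0 r (xi i)) /\
    f y - f x = \sum_i (y - x) 0 i * 'D_(delta_mx 0 i) f (xi i).
Proof.
move=> df [r0 bx] [_ by_].
pose z (k : nat) : 'rV[R]_n := \row_j (if (j < k)%N then y 0 j else x 0 j).
have step (k : 'I_n) : exists xi, ball x0 r xi /\
    f (z k.+1) - f (z k) = (y - x) 0 k * 'D_(delta_mx 0 k) f xi.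
  have zS : z k.+1 = (y 0 k - x 0 k) *: delta_mx 0 k + z k.
    apply/rowP => j; rewrite !mxE eqxx/= ltnS leq_eqVlt.
    have [->|jk] := eqVneq j k; first by rewrite eqxx ltnn mulr1 subrK.
    by rewrite (_ : (j == k :> nat) = false) ?(inj_eq val_inj) ?(negbTE jk)//
      mulr0 add0r.
  have H t : `|t| <= `|y 0 k - x 0 k| -> 0 <= t * (y 0 k - x 0 k) ->
      ball x0 r (t *: delta_mx 0 k + z k).
    move=> t1 t2; split=> // i j; rewrite (ord1 i) !mxE eqxx/=.
    have [->|jk] := eqVneq j k; last first.
      by rewrite mulr0 add0r; case: ifP => _; [exact: by_|exact: bx].
    rewrite ltnn mulr1; have := bx 0 k; have := by_ 0 k.
    rewrite /ball/= !ltr_norml => /andP[a1 a2] /andP[a3 a4].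
    have [yx|yx] := leP 0 (y 0 k - x 0 k).
      have t0 : 0 <= t.
        have [//|tn] := leP 0 t; move: t1 t2;
          rewrite (ger0_norm yx) ltr0_norm//.
        move: yx; rewrite le_eqVlt => /predU1P[<-|yx]; first by move=> ?; lra.
        by move=> _; rewrite pmulr_lge0// leNgt tn.
      by move: t1; rewrite !ger0_norm// => t1; apply/andP; split; lra.
    have t0 : t <= 0 by move: t2; rewrite nmulr_lge0.
    by move: t1; rewrite ler0_norm// ltr0_norm// => t1; apply/andP; split; lra.
  have [|t [t1 t2] E] := @MVT_dir n f (z k) (delta_mx 0 k) (y 0 k - x 0 k).
    by move=> t t1 t2; apply: df; exact: H.
  exists (t *: delta_mx 0 k + z k); split; first exact: H.
  by rewrite zS E !mxE.
exists (fun k => sval (cid (step k))); split=> [i|].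
  by have [] := svalP (cid (step i)).
under eq_bigr => i _ do have [_ <-] := svalP (cid (step i)).
rewrite -(big_mkord xpredT (fun k => f (z k.+1) - f (z k))) telescope_sumr//.
have -> : z n = y by apply/rowP => j; rewrite mxE ltn_ord.
by have -> : z 0%N = x by apply/rowP => j; rewrite mxE ltn0.
Qed.

Lemma smooth_mulmxr m n (U : set 'rV[R]_m) (A : 'M[R]_(m, n)) : open U ->
  smooth_on U (mulmxr A).
Proof.
move=> oU k; apply/Ck_onP => // j.
have := @Ck_fun_sum R m k U _ (index_enum 'I_m) xpredT
  (fun i x => x 0 i * A i j) oU.
move=> /(_ (fun i => Ck_funM oU (Ck_fun_coord k i oU) (Ck_fun_cst k _ oU))).
by apply: Ck_fun_ext => // x _; rewrite /= mxE.
Qed.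

Lemma mulmxr_continuous m n (A : 'M[R]_(m, n)) :
  continuous (mulmxr A : 'rV[R]_m -> 'rV[R]_n).
Proof.
by move=> x; have [/(_ x I)] := @smooth_mulmxr m n setT A openT 0%N.
Qed.

Lemma coord_le_norm n (v : 'rV[R]_n) i : `|v 0 i| <= `|v|.
Proof.
by rewrite [leRHS]/Num.Def.normr/= mx_normrE; exact: (le_bigmax _ _ (0, i)).
Qed.

Lemma norm_le_coord n (v : 'rV[R]_n) (a : R) : 0 <= a ->
  (forall i, `|v 0 i| <= a) -> `|v| <= a.
Proof.
move=> a0 va; rewrite [leLHS]/Num.Def.normr/= mx_normrE.
by rewrite bigmax_le// => -[i j] _; rewrite (ord1 i); exact: va.
Qed.

Lemma near_ball (V : normedModType R) (x : V) (P : V -> Prop) :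
  (\forall y \near x, P y) -> exists2 r : R, 0 < r & forall y, ball x r y ->
    P y.
Proof. by move=> /nbhs_ballP[r /= r0 H]; exists r. Qed.

(** The transpose of the usual Jacobian matrix: vectors are rows, so the differential is v |-> v *m
    jac f x. *)
Definition jac m n (f : 'rV[R]_m -> 'rV[R]_n) (x : 'rV[R]_m) : 'M[R]_(m, n) :=
  \matrix_(i, j) 'D_(delta_mx 0 i) f x 0 j.

(** By [MVT_box] the error is a combination of differences between partial derivatives at [x0] and
    at nearby points, which continuity makes small. Both [x] and [y] vary, as the inverse function
    theorem requires. *)
Lemma C1_strict_diff m n (U : set 'rV[R]_m)
    (f : 'rV[R]_m -> 'rV[R]_n) x0 (e : R) :
  open U -> Ck_on 1 U f -> U x0 -> 0 < e ->
  exists2 r : R, 0 < r & forall x y, ball x0 r x -> ball x0 r y ->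
    `|f y - f x - (y - x) *m jac f x0| <= e * `|y - x|.
Proof.
(* Each of the m coordinates contributes at most e' |y - x|; dividing by m + 1 keeps the denominator
   nonzero when m = 0. *)
move=> oU Cf Ux e0; pose e' := e / m.+1%:R.
have e'0 : 0 < e' by rewrite divr_gt0.
have [r r0 Hr] : exists2 r : R, 0 < r & forall y, ball x0 r y ->
    U y /\ forall i j, `|jac f x0 i j - 'D_(delta_mx 0 i) f y 0 j| < e'.
  have H : \forall y \near x0,
      forall i j, `|jac f x0 i j - 'D_(delta_mx 0 i) f y 0 j| < e'.
    apply: (@filter_forall _ _ (fun i y => forall j,
      `|jac f x0 i j - 'D_(delta_mx 0 i) f y 0 j| < e') (nbhs x0) _) => i.
    apply: (@filter_forall _ _ (fun j y =>
      `|jac f x0 i j - 'D_(delta_mx 0 i) f y 0 j| < e') (nbhs x0) _) => j.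
    have [_ /(_ i)[_ [+ _]]] := Cf => /(_ x0 Ux) /continuous_rVP /(_ j).
    move=> /cvgrPdist_lt /(_ _ e'0).
    by apply: filterS => y; rewrite mxE.
  by apply: near_ball; apply: filterI H; exact: open_nbhs_nbhs.
exists r => // x y bx by_.
apply: norm_le_coord; first by rewrite mulr_ge0// ltW.
move=> j; rewrite !mxE.
have [|xi [bxi E]] := @MVT_box m (fun y => f y 0 j) x0 x y r _ bx by_.
  move=> z i /Hr[Uz _]; have [_ /(_ i)[/(_ z Uz) + _]] := Cf.
  by move=> /derivable_mxP; exact.
rewrite E -sumrB (le_trans (ler_norm_sum _ _ _))//.
have -> : e * `|y - x| = m.+1%:R * (e' * `|y - x|).
  by rewrite mulrA (mulrC m.+1%:R) divfK// pnatr_eq0.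
rewrite mulr_natl (@le_trans _ _ (e' * `|y - x| *+ m))//; last first.
  by rewrite mulrS lerDr mulr_ge0// ltW.
rewrite -[X in _ *+ X]card_ord -sumr_const ler_sum// => i _.
rewrite -mulrBr normrM mulrC ler_pM//; last exact: coord_le_norm.
have [Uxi Hxi] := Hr _ (bxi i).
have [_ /(_ i)[/(_ _ Uxi) d _]] := Cf.
have -> : 'D_'e_i (fun y => f y 0 j) (xi i) = 'D_'e_i f (xi i) 0 j.
  by rewrite derive_mx// mxE.
by rewrite distrC ltW.
Qed.

Lemma is_diff_eps m n (f : 'rV[R]_m -> 'rV[R]_n) x (J : 'M[R]_(m, n)) :
  (forall e : R, 0 < e -> \forall h \near (0 : 'rV[R]_m),
    `|f (h + x) - f x - h *m J| <= e * `|h|) ->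
  is_diff x f (mulmxr J).
Proof.
move=> small.
have E : f \o shift x = cst (f x) + mulmxr J +o_ (0 : 'rV[R]_m) id.
  apply/eqaddoP => e e0; have := small e e0; apply: filterS => h /=.
  by rewrite !fctE/= opprD addrA.
have dE := diff_unique (@mulmxr_continuous _ _ J) E.
split; last exact: dE.
by apply/diff_locallyP; rewrite dE; split=> //; exact: mulmxr_continuous.
Qed.

Lemma C1_is_diff m n (U : set 'rV[R]_m) (f : 'rV[R]_m -> 'rV[R]_n) x : open U ->
  Ck_on 1 U f -> U x -> is_diff x f (mulmxr (jac f x)).
Proof.
move=> oU Cf Ux; apply: is_diff_eps => e e0.
have [r r0 Hr] := C1_strict_diff oU Cf Ux e0.
have := @nbhs0_lt _ 'rV[R]_m _ r0; apply: filterS => h hr.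
have bh : ball x r (h + x).
  by rewrite -ball_normE/= opprD addrCA subrr addr0 normrN.
by have := Hr x (h + x) (ballxx _ r0) bh; rewrite addrK.
Qed.

Lemma Ck_on_continuous m n k (U : set 'rV[R]_m) (f : 'rV[R]_m -> 'rV[R]_n) x :
  Ck_on k U f -> U x -> {for x, continuous f}.
Proof. by case: k => [|k] [cf _]; exact: cf. Qed.

Lemma Ck_onW m n k (U : set 'rV[R]_m) (f : 'rV[R]_m -> 'rV[R]_n) :
  Ck_on k.+1 U f -> Ck_on k U f.
Proof.
elim: k f => [|k IH] f [cf df]; split=> // i.
by have [d1 d2] := df i; split=> //; exact: IH.
Qed.

Lemma Ck_on1 m n k (U : set 'rV[R]_m) (f : 'rV[R]_m -> 'rV[R]_n) :
  Ck_on k.+1 U f -> Ck_on 1 U f.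
Proof.
move=> [cf df]; split=> [//|i]; have [d1 d2] := df i; split=> [//|].
by split; [move=> x; exact: Ck_on_continuous d2|].
Qed.

Lemma Ck_on_diff m n k (U : set 'rV[R]_m) (f : 'rV[R]_m -> 'rV[R]_n) x :
  open U ->
  Ck_on k.+1 U f -> U x -> differentiable f x.
Proof. by move=> oU /Ck_on1 Cf Ux; have [] := C1_is_diff oU Cf Ux. Qed.

Lemma Ck_on_ext m n k (U : set 'rV[R]_m) (f g : 'rV[R]_m -> 'rV[R]_n) :
  open U ->
  (forall x, U x -> f x = g x) -> Ck_on k U f -> Ck_on k U g.
Proof.
move=> oU fg /Ck_onP Cf; apply/Ck_onP => // j.
by apply: Ck_fun_ext (Cf oU j) => // x Ux; rewrite fg.
Qed.

(** Induction on [k] with [g] varying: by the chain rule a partial derivative of the composite is a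
    sum of products of a partial derivative of [f] with a partial derivative of [g] composed with
    [f], and the induction hypothesis applies to the latter. *)
Lemma Ck_on_comp m n p k (U : set 'rV[R]_m) (V : set 'rV[R]_n)
    (f : 'rV[R]_m -> 'rV[R]_n) (g : 'rV[R]_n -> 'rV[R]_p) :
  open U -> open V -> (forall x, U x -> V (f x)) ->
  Ck_on k U f -> Ck_on k V g -> Ck_on k U (g \o f).
Proof.
move=> oU oV fUV; elim: k g => [|k IH] g Cf Cg.
  split; [move=> x Ux; apply: continuous_comp|by []].
    exact: Ck_on_continuous Cf Ux.
  exact: Ck_on_continuous Cg (fUV _ Ux).
split=> [x Ux|i].
  apply: continuous_comp; first exact: Ck_on_continuous Cf Ux.
  exact: Ck_on_continuous Cg (fUV _ Ux).
have dgf x : U x -> differentiable (g \o f) x.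
  move=> Ux; apply: differentiable_comp; first exact: Ck_on_diff Cf Ux.
  exact: Ck_on_diff Cg (fUV _ Ux).
split=> [x Ux|]; first exact/diff_derivable/dgf.
apply/Ck_onP => // j.
have [_ /(_ i)[_ Cfi]] := Cf.
have CD (l : 'I_n) : Ck_fun k U (fun x => 'D_(delta_mx 0 i) f x 0 l *
    ('D_(delta_mx 0 l) g \o f) x 0 j).
  apply: Ck_funM => //; first by move/Ck_onP : Cfi; exact.
  have [_ /(_ l)[_ Cgl]] := Cg.
  by have /Ck_onP := IH _ (Ck_onW Cf) Cgl; exact.
apply: Ck_fun_ext (Ck_fun_sum (index_enum 'I_n) xpredT oU CD) => // x Ux.
have df := Ck_on_diff oU Cf Ux; have dg := Ck_on_diff oV Cg (fUV _ Ux).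
rewrite [in RHS]deriveE; last exact: dgf.
rewrite diff_comp//= -(deriveE _ df).
have [_ ->] := C1_is_diff oV (Ck_on1 Cg) (fUV _ Ux).
by rewrite /= mxE; apply: eq_bigr => l _; rewrite mxE.
Qed.

Lemma Ck_fun_jac m n k (U : set 'rV[R]_m) (f : 'rV[R]_m -> 'rV[R]_n) i j :
  open U -> Ck_on k.+1 U f -> Ck_fun k U (fun x => jac f x i j).
Proof.
move=> oU [_ /(_ i)[_ Cfi]]; have /(Ck_onP _ _ oU)/(_ j) :
  Ck_on k U ('D_(delta_mx 0 i) f) by [].
by apply: Ck_fun_ext => // x _; rewrite mxE.
Qed.

End CkVector.

(** * Smooth maps between open subsets of coordinate spaces *)

Section SmoothOn.
Variable R : realType.

Lemma smooth_onP m n (U : set 'rV[R]_m) (f : 'rV[R]_m -> 'rV[R]_n) : open U ->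
  smooth_on U f <-> forall k j, Ck_fun k U (fun x => f x 0 j).
Proof.
move=> oU; split=> [sf k|sf k]; first by apply/Ck_onP => //; exact: sf.
by apply/Ck_onP => // j; exact: sf.
Qed.

Lemma smooth_on_ext m n (U : set 'rV[R]_m) (f g : 'rV[R]_m -> 'rV[R]_n) :
  open U ->
  (forall x, U x -> f x = g x) -> smooth_on U f -> smooth_on U g.
Proof. by move=> oU fg sf k; exact: Ck_on_ext oU fg (sf k). Qed.

Lemma smooth_on_comp m n p (U : set 'rV[R]_m) (V : set 'rV[R]_n)
    (f : 'rV[R]_m -> 'rV[R]_n) (g : 'rV[R]_n -> 'rV[R]_p) :
  open U -> open V -> (forall x, U x -> V (f x)) ->
  smooth_on U f -> smooth_on V g -> smooth_on U (g \o f).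
Proof. by move=> oU oV fUV sf sg k; exact: Ck_on_comp fUV (sf k) (sg k). Qed.

(** Every clause of [Ck_on] is a condition at single points on a total function, so it can be
    checked with a different [V] at each point. *)
Lemma Ck_on_local m n k (U : set 'rV[R]_m) (f : 'rV[R]_m -> 'rV[R]_n) :
  (forall x, U x -> exists2 V, V x & Ck_on k V f) -> Ck_on k U f.
Proof.
elim: k f => [|k IH] f loc.
  by split; [move=> x /loc[V Vx [cf _]]; exact: cf|].
split; first by move=> x /loc[V Vx [cf _]]; exact: cf.
move=> i; split.
  by move=> x /loc[V Vx [_ /(_ i)[d1 _]]]; exact: d1.
by apply: IH => x /loc[V Vx [_ /(_ i)[_ d2]]]; exists V.
Qed.

Lemma smooth_on_local m n (U : set 'rV[R]_m) (f : 'rV[R]_m -> 'rV[R]_n) :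
  (forall x, U x -> exists2 V, V x & smooth_on V f) -> smooth_on U f.
Proof.
move=> loc k; apply: Ck_on_local => x /loc[V Vx sf].
by exists V => //; exact: sf.
Qed.

Lemma smooth_on_sub m n (U V : set 'rV[R]_m) (f : 'rV[R]_m -> 'rV[R]_n) :
  V `<=` U -> smooth_on U f -> smooth_on V f.
Proof. by move=> VU sf; apply: smooth_on_local => x /VU Ux; exists U. Qed.

Lemma smooth_on_continuous m n (U : set 'rV[R]_m) (f : 'rV[R]_m -> 'rV[R]_n) x :
  smooth_on U f -> U x -> {for x, continuous f}.
Proof. by move=> /(_ 0%N); exact: Ck_on_continuous. Qed.

Lemma smooth_on_diff m n (U : set 'rV[R]_m) (f : 'rV[R]_m -> 'rV[R]_n) x :
  open U -> smooth_on U f -> U x -> is_diff x f (mulmxr (jac f x)).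
Proof. by move=> oU /(_ 1%N); exact: C1_is_diff. Qed.

Lemma smooth_on_id m (U : set 'rV[R]_m) : open U -> smooth_on U id.
Proof. by move=> oU; apply/smooth_onP => // k j; exact: Ck_fun_coord. Qed.

Lemma smooth_on_row_mx m n p (U : set 'rV[R]_m)
    (f : 'rV[R]_m -> 'rV[R]_n) (g : 'rV[R]_m -> 'rV[R]_p) : open U ->
  smooth_on U f -> smooth_on U g -> smooth_on U (fun x => row_mx (f x) (g x)).
Proof.
move=> oU /smooth_onP sf /smooth_onP sg; apply/smooth_onP => // k j.
rewrite -(splitK j); case: (fintype.split j) => i /=.
  by apply: Ck_fun_ext (sf oU k i) => // x _; rewrite row_mxEl.
by apply: Ck_fun_ext (sg oU k i) => // x _; rewrite row_mxEr.
Qed.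

Lemma smooth_on_lsubmx n p (U : set 'rV[R]_(n + p)) : open U ->
  smooth_on U (fun x => lsubmx x).
Proof.
move=> oU; apply/smooth_onP => // k j.
by apply: Ck_fun_ext (Ck_fun_coord k (lshift p j) oU) => // x _; rewrite mxE.
Qed.

Lemma smooth_on_rsubmx n p (U : set 'rV[R]_(n + p)) : open U ->
  smooth_on U (fun x => rsubmx x).
Proof.
move=> oU; apply/smooth_onP => // k j.
by apply: Ck_fun_ext (Ck_fun_coord k (rshift n j) oU) => // x _; rewrite mxE.
Qed.

Lemma open_preimage (T S : topologicalType) (U : set T) (V : set S)
    (f : T -> S) :
  open U -> open V -> (forall x, U x -> {for x, continuous f}) ->
  open (U `&` f @^-1` V).
Proof.
move=> oU oV cf; rewrite openE => x [Ux Vfx]; apply: filterI.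
  exact: open_nbhs_nbhs.
by apply: (cf x Ux); exact: open_nbhs_nbhs.
Qed.

End SmoothOn.

(** * The inverse function theorem *)

Section InverseFunction.
Variable R : realType.

Lemma continuous_dist (V W : normedModType R) (F : V -> W) x :
  (forall e : R, 0 < e -> \forall z \near x, `|F x - F z| < e) ->
  {for x, continuous F}.
Proof. by move=> H; apply/cvgrPdist_lt. Qed.

Lemma near_dist (V : normedModType R) (x : V) (e : R) : 0 < e ->
  \forall z \near x, `|x - z| < e.
Proof. by move=> e0; have := nbhsx_ballx x e e0; rewrite -ball_normE. Qed.

Lemma near_in_ball (V : normedModType R) (x y : V) (r : R) : ball x r y ->
  \forall z \near y, ball x r z.
Proof. by move=> xy; apply: open_nbhs_nbhs; split=> //; exact: ball_open. Qed.

Lemma continuous_norm_sub (T : topologicalType) (V : normedModType R)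
    (F : T -> V) y x :
  {for x, continuous F} -> {for x, continuous (fun z => `|y - F z|)}.
Proof. by move=> cF; apply: cvg_norm; apply: cvgB => //; exact: cvg_cst. Qed.

(* A minimiser x of |y - F x| on the closed ball of radius r / 2 is a preimage of
   y: the step from x to x + (y - F x) stays in that ball and would halve the
   distance. *)
Lemma near_id_surjective n (F : 'rV[R]_n -> 'rV[R]_n) (x0 : 'rV[R]_n) (r : R) :
  0 < r ->
  (forall x y : 'rV[R]_n, ball x0 r x -> ball x0 r y ->
     `|F y - F x - (y - x)| <= 2^-1 * `|y - x|) ->
  forall y : 'rV[R]_n, ball (F x0) (r / 4) y ->
  exists2 x : 'rV[R]_n, ball x0 r x & F x = y.
Proof.
move=> r0 HF y ybr; have yr : `|F x0 - y| < r / 4 by move: ybr;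
  rewrite -ball_normE.
pose A : set 'rV[R]_n := [set x | `|x0 - x| <= r / 2].
have AB x : A x -> ball x0 r x.
  move=> Ax; rewrite -ball_normE/=; apply: le_lt_trans Ax _.
  by rewrite ltr_pdivrMr// ltr_pMr// ltr1n.
have A0 : A x0 by rewrite /A/= subrr normr0 divr_ge0// ltW.
have cF (x : 'rV[R]_n) : ball x0 r x -> {for x, continuous F}.
  move=> bx; apply: continuous_dist => e e0.
  have e20 : 0 < e / 2 by rewrite divr_gt0.
  apply: filterS2 (near_in_ball bx) (near_dist x e20) => z bz zx.
  have Hz := HF z x bz bx.
  have : `|F x - F z| <= `|F x - F z - (x - z)| + `|x - z|.
    by apply: le_trans (ler_normD _ _); rewrite subrK.
  by move: Hz zx => ? ? ?; lra.
have clA : closed A.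
  rewrite (_ : A = closed_ball x0 (r / 2)); last first.
    by rewrite closed_ballE// divr_gt0.
  exact: closed_ball_closed.
have cA : compact A.
  apply: bounded_closed_compact => //.
  exists (`|x0| + r / 2); split; first exact: num_real.
  move=> M HM x Ax; apply: le_trans (ltW HM).
  by rewrite -[x](subKr x0) (le_trans (ler_normB _ _))// lerD2l.
have [||x] := @EVT_min_rV R n (fun x => `|y - F x|) A _ cA.
- by exists x0.
- apply: continuous_in_subspaceT => x; rewrite inE => /AB /cF cFx.
  exact: continuous_norm_sub.
rewrite inE => Ax Hmin; exists x; first exact: AB.
pose x' := x + (y - F x).
have Ax' : A x'.
  have H := HF x x0 (AB _ Ax) (AB _ A0).
  have -> : A x' = (`|(F x0 - y) - (F x0 - F x - (x0 - x))| <= r / 2) :> Prop.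
    by congr (is_true (`|_| <= _)); apply/rowP => j; rewrite !mxE; ring.
  have : `|F x0 - y - (F x0 - F x - (x0 - x))| <= `|F x0 - y| + `|F x0 - F x -
    (x0 - x)|.
    exact: ler_normB.
  by move: H Ax yr; rewrite /A/=; lra.
have : `|y - F x'| <= 2^-1 * `|y - F x|.
  have := HF x x' (AB _ Ax) (AB _ Ax').
  have -> : x' - x = y - F x by rewrite /x' addrC addKr.
  by rewrite opprB addrA subrK distrC.
have := Hmin x'; rewrite inE => /(_ Ax') h1 h2.
have : `|y - F x| <= 0 by lra.
by rewrite normr_le0 subr_eq0 => /eqP.
Unshelve. all: by end_near. Qed.


(** After multiplication by the inverse Jacobian at [x0], [f] becomes a map [F] close to the
    identity. That single estimate gives surjectivity by [near_id_surjective], injectivity, and a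
    Lipschitz bound for the inverse [h]; differentiability and then smoothness of [h] follow. *)
Lemma inverse_function n (U : set 'rV[R]_n) (f : 'rV[R]_n -> 'rV[R]_n) x0 :
  open U -> U x0 -> smooth_on U f -> jac f x0 \in unitmx ->
  exists V W h, [/\ open V, V x0, V `<=` U & open W] /\
    [/\ forall x, V x -> W (f x) /\ h (f x) = x,
        forall y, W y -> V (h y) /\ f (h y) = y & smooth_on W h].
Proof.
move=> oU Ux0 sf J0; set A := invmx (jac f x0).
have [C C0 HC] : exists2 C : R, 0 < C & forall v : 'rV[R]_n,
  `|v *m A| <= C * `|v|.
  exact: (linear_lipschitz (@mulmxr_continuous R n n A)).
have Cjac i j : Ck_fun 0 U (fun x => jac f x i j) by exact: Ck_fun_jac (sf 1%N).
have [r r0 [Ur [Jr Hr]]] : exists2 r : R, 0 < r &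
    (forall x : 'rV[R]_n, ball x0 r x -> U x) /\
    (forall x : 'rV[R]_n, ball x0 r x -> jac f x \in unitmx) /\
    forall x y : 'rV[R]_n, ball x0 r x -> ball x0 r y ->
    `|f y - f x - (y - x) *m jac f x0| <= (2 * C)^-1 * `|y - x|.
  (* Multiplying by [A] costs a factor C, so an error of 1/(2C) for [f] becomes the error 1/2 for
     [F]. *)
  have [|r1 r10 H1] := @C1_strict_diff R n n U f x0 (2 * C)^-1 oU (sf 1%N) Ux0.
    by rewrite invr_gt0 mulr_gt0.
  have [r2 r20 H2] : exists2 r : R, 0 < r & forall y, ball x0 r y ->
      U y /\ \det (jac f y) != 0.
    apply: near_ball; apply: filterI; first exact: open_nbhs_nbhs.
    have /(_ x0 Ux0) cd := Ck_fun_continuous (Ck_fun_det oU Cjac).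
    apply: (cvgr_neq0 _ cd).
    by rewrite -unitfE -unitmxE.
  exists (Num.min r1 r2); first by rewrite lt_min r10.
  have b1 x : ball x0 (Num.min r1 r2) x -> ball x0 r1 x.
    by apply: le_ball; rewrite ge_min lexx.
  have b2 x : ball x0 (Num.min r1 r2) x -> ball x0 r2 x.
    by apply: le_ball; rewrite ge_min lexx orbT.
  split; first by move=> x /b2 /H2[].
  split; first by move=> x /b2 /H2[_]; rewrite unitmxE unitfE.
  by move=> x y /b1 bx /b1 by_; exact: H1.
pose F x := f x *m A.
have HF (x y : 'rV[R]_n) : ball x0 r x -> ball x0 r y ->
    `|F y - F x - (y - x)| <= 2^-1 * `|y - x|.
  move=> bx by_; have -> : F y - F x - (y - x) =
    (f y - f x - (y - x) *m jac f x0) *m A.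
    by rewrite !mulmxBl mulmxK// mulmxK.
  apply: le_trans (HC _) _; rewrite -ler_pdivlMl// mulrA -invfM [C * 2]mulrC.
  exact: Hr.
(* Since [F] moves differences by at most half their length, it cannot contract by more than a
   factor 2. This yields injectivity of [f] on the ball and the Lipschitz constant 2C of [h]. *)
have sub x y : ball x0 r x -> ball x0 r y -> `|y - x| <= 2 * `|F y - F x|.
  move=> bx by_; have h1 := HF _ _ bx by_.
  have : `|y - x| <= `|F y - F x| + `|F y - F x - (y - x)|.
    by apply: le_trans (ler_normB _ _); rewrite subKr.
  by move: h1; lra.
pose W : set 'rV[R]_n := [set y | ball (F x0) (r / 4) (y *m A)].
have oW : open W.
  have := @open_comp _ _ (mulmxr A : 'rV[R]_n -> 'rV[R]_n)
    (ball (F x0) (r / 4)).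
  by apply; [move=> x _; exact: mulmxr_continuous|exact: ball_open].
have surj y : W y -> exists2 x : 'rV[R]_n, ball x0 r x & f x = y.
  move=> Wy; have [x bx Fx] := near_id_surjective r0 HF Wy.
  exists x => //.
  have : F x *m jac f x0 = y by rewrite Fx mulmxKV.
  by rewrite /F mulmxKV.
pose h y := xget x0 [set x : 'rV[R]_n | ball x0 r x /\ f x = y].
have hP y : W y -> ball x0 r (h y) /\ f (h y) = y.
  move=> Wy; apply: (@xgetPex _ x0 [set x : 'rV[R]_n | ball x0 r x /\ f x = y]).
  by have [x bx fx] := surj y Wy; exists x.
pose V := ball x0 r `&` f @^-1` W.
have cf x : ball x0 r x -> {for x, continuous f}.
  by move=> /Ur; exact: smooth_on_continuous sf.
have oV : open V by apply: open_preimage => //; exact: ball_open.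
have hV y : W y -> V (h y).
  by move=> Wy; have [bh fh] := hP y Wy; split=> //; rewrite /preimage/= fh.
have dh y : W y -> is_diff y h (mulmxr (invmx (jac f (h y)))).
  move=> Wy; have [bx fx] := hP y Wy; set x := h y.
  have lip z : W z -> `|h z - x| <= 2 * C * `|z - y|.
    move=> Wz; have [bz fz] := hP z Wz; apply: le_trans (sub _ _ bx bz) _.
    by rewrite -mulrA ler_pM2l// /F fx fz -mulmxBl; exact: HC.
  have [D D0 HD] : exists2 D : R, 0 < D &
      forall v : 'rV[R]_n, `|v *m invmx (jac f x)| <= D * `|v|.
    exact: (linear_lipschitz (@mulmxr_continuous R n n (invmx (jac f x)))).
  apply: is_diff_eps => e e0.
  (* The strict differentiability error of [f] at x is enlarged by 2C, the Lipschitz constant of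
     [h], and by D, the bound for the inverse Jacobian at x. *)
  pose e' := e / (D * (2 * C)).
  have e'0 : 0 < e' by rewrite divr_gt0// !mulr_gt0.
  have [s s0 Hs] := C1_strict_diff oU (sf 1%N) (Ur _ bx) e'0.
  have [t t0 Ht] := near_ball (open_nbhs_nbhs (conj oW Wy)).
  have u0 : 0 < Num.min t (s / (2 * C))
    by rewrite lt_min t0 divr_gt0// mulr_gt0.
  have := @nbhs0_lt _ 'rV[R]_n _ u0; apply: filterS => k.
  rewrite lt_min => /andP[kt ks].
  have Wk : W (k + y).
    by apply: Ht; rewrite -ball_normE/= opprD addrCA subrr addr0 normrN.
  have [bk fk] := hP _ Wk.
  have lk := lip _ Wk; rewrite addrK in lk.
  have bs : ball x s (h (k + y)).
    rewrite -ball_normE/= distrC (le_lt_trans lk)//.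
    by rewrite mulrC -ltr_pdivlMr// mulr_gt0.
  have := Hs x (h (k + y)) (ballxx _ s0) bs.
  rewrite fk fx addrK => H.
  have -> : h (k + y) - x - k *m invmx (jac f x) =
      - ((k - (h (k + y) - x) *m jac f x) *m invmx (jac f x)).
    by rewrite mulmxBl (mulmxK (Jr _ bx)) opprB.
  rewrite normrN (le_trans (HD _))//.
  rewrite -ler_pdivlMl// (le_trans H)//.
  apply: (@le_trans _ _ (e' * (2 * C * `|k|))); first by rewrite ler_pM2l.
  rewrite mulrA /e' le_eqVlt; apply/orP; left; apply/eqP.
  by field; rewrite !gt_eqF.
exists V, W, h; split.
  split=> //; last by move=> x [/Ur].
  split; first exact: ballxx.
  by rewrite /preimage/= /W/=; apply: ballxx; rewrite divr_gt0.
split=> [x [bx Wx]|y Wy|].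
- split=> //; have [bh fh] := hP _ Wx.
  have := sub _ _ bx bh; rewrite /F fh subrr normr0 mulr0.
  by rewrite normr_le0 subr_eq0 => /eqP.
- by split; [exact: hV|have [] := hP y Wy].
(* Bootstrapping: the partial derivatives of [h] are the rows of the inverse Jacobian of [f]
   composed with [h], so they are as regular as [h] is already known to be. *)
- elim=> [|k IH].
    by split; [move=> y /dh[dy _]; exact: differentiable_continuous|].
  split=> [y /dh[dy _]|i]; first exact: differentiable_continuous.
  split=> [y /dh[dy _]|]; first exact: diff_derivable.
  pose K x := row i (invmx (jac f x)).
  have CK : Ck_on k V K.
    apply/Ck_onP => // j.
    have : Ck_fun k V (fun x => invmx (jac f x) i j).
      apply: (@Ck_fun_invmx R n k V n (jac f) i j oV) => [a b|x [bx _]];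
        last exact: Jr.
      apply: (@Ck_fun_sub R n k U) (Ck_fun_jac a b oU (sf k.+1)).
      by move=> x [/Ur].
    by apply: Ck_fun_ext => // x _; rewrite mxE.
  have := Ck_on_comp oW oV hV IH CK.
  apply: Ck_on_ext => // y Wy; have [dy Dy] := dh y Wy.
  by rewrite deriveE// Dy/= /K rowE.
Qed.

End InverseFunction.

(** * Local normal form of submersions *)

Section SubmersionForm.
Variable R : realType.

(** Gaussian elimination writes [J] as [col_ebase J] times [row_ebase J] stacked on 0. With the last
    k columns of [col_ebase J] as N, the completed matrix is [col_ebase J] times an invertible block
    diagonal matrix. *)
Lemma complete_unitmx n k (J : 'M[R]_(n + k, n)) : row_full J ->
  exists N : 'M[R]_(n + k, k), row_mx J N \in unitmx.
Proof.
move=> /eqP rJ; exists (col_ebase J *m col_mx 0 1%:M).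
have EJ : J = col_ebase J *m col_mx (row_ebase J) 0.
  have {1}<- := mulmx_ebase J; rewrite rJ -mulmxA; congr (_ *m _).
  by rewrite pid_mx_col mul_col_mx mul1mx mul0mx.
rewrite {1}EJ -mul_mx_row unitmx_mul col_ebase_unit/=.
rewrite -block_mxEh unitmxE det_lblock det1 mulr1 -unitmxE.
exact: row_ebase_unit.
Qed.

Lemma surjective_row_full p n (J : 'M[R]_(p, n)) :
  (forall w : 'rV_n, exists v : 'rV_p, v *m J = w) -> row_full J.
Proof.
move=> sJ; have /choice[B HB] : forall i : 'I_n, exists v : 'rV_p,
  v *m J = delta_mx 0 i.
  by move=> i; exact: sJ.
apply/row_fullP; exists (\matrix_i B i); apply/row_matrixP => i.
by rewrite row_mul rowK HB row1.
Qed.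

(** The map v |-> (g v, v N) has Jacobian (J, N), where N completes the Jacobian J of [g] to an
    invertible matrix, so the inverse function theorem makes it a local coordinate change turning
    [g] into a projection. *)
Lemma submersion_normal_form p n (V : set 'rV[R]_p)
    (g : 'rV[R]_p -> 'rV[R]_n) v0 :
  open V -> V v0 -> smooth_on V g -> (forall w, exists v, 'd g v0 v = w) ->
  p = (n + (p - n))%N /\
  exists (V0 : set 'rV[R]_p) (W : set 'rV[R]_(n + (p - n))) th th',
    [/\ open V0, V0 v0, V0 `<=` V & open W] /\
    [/\ smooth_on V0 th, smooth_on W th',
        forall v, V0 v -> W (th v) /\ th' (th v) = v,
        forall w, W w -> V0 (th' w) /\ th (th' w) = w &
        forall v, V0 v -> lsubmx (th v) = g v].
Proof.
move=> oV Vv0 sg; have [dg dgE] := smooth_on_diff oV sg Vv0.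
rewrite dgE => /surjective_row_full fJ.
have np : (n <= p)%N by rewrite -(eqP fJ) rank_leq_row.
have pE : p = (n + (p - n))%N by rewrite subnKC.
(* Generalising the difference to [k] allows [p] itself to be replaced by n + k, so that block
   matrices typecheck. *)
split=> //; move: (p - n)%N pE => k pE.
move: V g v0 oV Vv0 sg dg dgE fJ; rewrite {np}pE => V g v0 oV Vv0 sg dg dgE fJ.
have [N uN] := complete_unitmx fJ.
pose th v := row_mx (g v) (v *m N).
have sth : smooth_on V th.
  by apply: smooth_on_row_mx => //; exact: smooth_mulmxr.
have jth : jac th v0 = row_mx (jac g v0) N.
  apply/matrixP => i j.
  have [/(@diff_derivable _ _ _ _ _ (delta_mx 0 i)) dth _] :=
    smooth_on_diff oV sth Vv0.
  rewrite mxE derive_mx// mxE -(splitK j); case: (fintype.split j) => a /=.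
    rewrite row_mxEl mxE.
    have dgi : derivable g v0 (delta_mx 0 i) by exact: diff_derivable.
    have -> : (fun v => th v 0 (lshift k a)) = (fun v => g v 0 a).
      by apply/funext => v; rewrite row_mxEl.
    by rewrite (derive_mx dgi) mxE.
  have -> : (fun v => th v 0 (rshift n a)) = (fun v => (v *m N) 0 a).
    by apply/funext => v; rewrite row_mxEr.
  have dNi : derivable (mulmxr N : 'rV_(n + k) -> 'rV_k) v0 (delta_mx 0 i).
    by apply/diff_derivable/linear_differentiable; exact: mulmxr_continuous.
  have /rowP/(_ a) := derive_mx dNi; rewrite mxE => <-.
  rewrite row_mxEr deriveE; last by apply: linear_differentiable;
    exact: mulmxr_continuous.
  rewrite diff_lin; last exact: mulmxr_continuous.
  by rewrite /= -rowE mxE.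
have [|V0 [W [h [[oV0 V0v0 V0V oW] [H1 H2 sh]]]]] :=
  inverse_function oV Vv0 sth.
  by rewrite jth.
exists V0, W, th, h; split=> //; split=> //.
  exact: smooth_on_sub V0V sth.
by move=> v _; rewrite row_mxKl.
Qed.

End SubmersionForm.

(** * Charts of diffeological spaces *)

Section DiffeologicalCharts.
Variable R : realType.
Implicit Types X Y Z : diffspace R.

(* c is a diffeomorphism from a D-open subset of X onto an open subset of R^n. *)
Definition dchart n X (c : chart R n X) : Prop :=
  plot (cmap c @` cdom c) (cinv c) /\
  forall m (U : set 'rV[R]_m) (p : 'rV[R]_m -> X), plot U p ->
    open (U `&` p @^-1` cdom c) /\
    smooth_on (U `&` p @^-1` cdom c) (cmap c \o p).

Definition is_manifold n X : Prop :=
  forall x : X, exists2 c : chart R n X, dchart c & cdom c x.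

Lemma cmap_img n (M : Type) (c : chart R n M) x :
  cdom c x -> (cmap c @` cdom c) (cmap c x).
Proof. by exists x. Qed.

Lemma cinv_dom n (M : Type) (c : chart R n M) u : (cmap c @` cdom c) u ->
  cdom c (cinv c u) /\ cmap c (cinv c u) = u.
Proof. by move=> [x cx <-]; rewrite cdomK. Qed.

Lemma cmap_inj n (M : Type) (c : chart R n M) x y :
  cdom c x -> cdom c y -> cmap c x = cmap c y -> x = y.
Proof. by move=> cx cy xy; rewrite -(cdomK cx) -(cdomK cy) xy. Qed.

Lemma cmap_img_setI n (M : Type) (c : chart R n M) (O : set M) :
  cmap c @` (cdom c `&` O) = (cmap c @` cdom c) `&` cinv c @^-1` O.
Proof.
apply/seteqP; split=> [_ [x [cx Ox] <-]|u [cu Ou]].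
  by split; [exact: cmap_img|rewrite /preimage/= cdomK].
by have [cx <-] := cinv_dom cu; exists (cinv c u).
Qed.

Lemma plot_sub X n (U V : set 'rV[R]_n) (p : 'rV[R]_n -> X) :
  plot U p -> open V -> V `<=` U -> plot V p.
Proof.
move=> pp oV VU.
exact: (plot_comp (f := id) pp oV (smooth_on_id oV) VU).
Qed.

(** The inverse of [c] is a plot, hence so is its composite with [F], and [d] reads plots as smooth
    maps. Here diffeological smoothness becomes smoothness in charts. *)
Lemma dchart_smooth n m X Y (c : chart R n X) (d : chart R m Y) (F : X -> Y) :
  dsmooth F -> dchart c -> dchart d -> chart_smooth c d F.
Proof.
move=> sF [pc _] [_ Hd]; rewrite /chart_smooth cmap_img_setI.
exact: (Hd _ _ _ (sF _ _ _ pc)).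
Qed.

Lemma dsmooth_id X : dsmooth (id : X -> X).
Proof. by []. Qed.

Lemma dsmooth_comp X Y Z (G : Y -> Z) (F : X -> Y) :
  dsmooth F -> dsmooth G -> dsmooth (G \o F).
Proof. by move=> sF sG n U p /sF /sG. Qed.

Lemma manifold_dchart X (M : manifold_structure X) (c : chart R (mdim M) X) :
  charts M c -> dchart c.
Proof.
move=> Mc; split=> [|m U p pp]; last by have [_ /(_ c Mc)] :=
  (mplots M U p).1 pp.
apply/(mplots M); split=> [|d Md]; first exact: cimg_open.
by have := charts_compat Mc Md; rewrite /chart_smooth cmap_img_setI.
Qed.

(** All diffeological charts together form an atlas, compatible because the identity is smooth. A
    parametrisation smooth in every chart is a plot on each preimage of a chart domain, hence a plot
    by locality. The existential over [True] makes a proposition of inhabitedness. *)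
Lemma is_manifold_structure n X : is_manifold n X ->
  exists M : manifold_structure X, True.
Proof.
move=> HX.
pose A := @Atlas R n X (@dchart n X) HX
  (fun c d hc hd => dchart_smooth (@dsmooth_id X) hc hd).
suff H m (U : set 'rV[R]_m) (p : 'rV[R]_m -> X) : plot U p <->
  smooth_param A U p.
  by exists (ManifoldStructure H).
split=> [pp|[oU Hp]].
  by split=> [|c [_ Hc]]; [exact: plot_open pp|exact: Hc].
pose C := [set W : set 'rV[R]_m | exists2 c : chart R n X, dchart c &
  W = U `&` p @^-1` cdom c].
apply: (@plot_local _ X m U p C).
- by move=> _ [c Ac ->]; have [] := Hp c Ac.
- apply/seteqP; split=> [u Uu|u [_ [c Ac ->] []]//].
  by have [c Ac cu] := HX (p u); exists (U `&` p @^-1` cdom c) => //; exists c.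
- move=> _ [c Ac ->]; have [oW sW] := Hp c Ac.
  apply: (@plot_ext _ X _ _ (cinv c \o (cmap c \o p))) => [u [_ cu]|].
    by rewrite /= cdomK.
  by apply: (plot_comp Ac.1 oW sW) => u [_ cu]; exact: cmap_img.
Qed.

Lemma dsmooth_mfd X Y (MX : manifold_structure X) (MY : manifold_structure Y)
  (F : X -> Y) : dsmooth F -> mfd_smooth MX MY F.
Proof.
by move=> sF c d /manifold_dchart hc /manifold_dchart hd; exact: dchart_smooth.
Qed.

Lemma ddiffeo_mfd X Y (MX : manifold_structure X) (MY : manifold_structure Y)
  (F : X -> Y) : ddiffeo F -> mfd_diffeo MX MY F.
Proof.
move=> [sF [G [sG FK GK]]]; split; first exact: dsmooth_mfd.
by exists G; split=> //; exact: dsmooth_mfd.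
Qed.

(** The hypotheses make [F] a diffeomorphism onto a D-open subset of [Y], stated through plots: the
    range is open along every plot, and plots in the range lift. Charts are then transported along
    [F]. *)
Lemma dchart_push n X Y (F : X -> Y) (c : chart R n X) x0 :
  dchart c -> cdom c x0 -> dsmooth F -> injective F ->
  (forall m (U : set 'rV[R]_m) p, plot U p -> open (U `&` p @^-1` range F)) ->
  (forall m (U : set 'rV[R]_m) p, plot U p ->
    (forall u, U u -> range F (p u)) ->
    exists2 q : 'rV[R]_m -> X, plot U q & forall u, U u -> F (q u) = p u) ->
  exists2 d : chart R n Y, dchart d & cdom d (F x0).
Proof.
move=> [pc Hc] cx0 sF iF oF lF.
pose G y := if pselect (exists x, F x = y) is left e then sval (cid e) else x0.
have FK x : G (F x) = x.
  rewrite /G; case: pselect => [e|[]]; last by exists x.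
  by apply: iF; exact: (svalP (cid e)).
have dK y : (F @` cdom c) y -> (F \o cinv c) ((cmap c \o G) y) = y.
  by move=> [x cx <-]; rewrite /= FK cdomK.
have imE : (cmap c \o G) @` (F @` cdom c) = cmap c @` cdom c.
  apply/seteqP; split=> [_ [_ [x cx <-] <-]|_ [x cx <-]].
    by rewrite /= FK; exists x.
  by exists (F x); [exists x|rewrite /= FK].
have oim : open ((cmap c \o G) @` (F @` cdom c)).
  by rewrite imE; exact: cimg_open.
exists (Chart dK oim); last by exists x0.
split=> /=; first by rewrite imE; exact: sF pc.
move=> m U p pp; have oW := oF _ _ _ pp.
have [q pq Fq] := lF m _ p (plot_sub pp oW (@subIsetl _ _ _))
  (fun u (h : (U `&` p @^-1` range F) u) => h.2).
have [oV sV] := Hc _ _ _ pq.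
have -> : U `&` p @^-1` (F @` cdom c) =
    (U `&` p @^-1` range F) `&` q @^-1` cdom c.
  apply/seteqP; split=> u.
    move=> [Uu [x cx xu]]; have Wu : (U `&` p @^-1` range F) u.
      by split=> //; exists x.
    by split=> //; have := Fq u Wu; rewrite -xu => /iF;
      rewrite /preimage/= => ->.
  by move=> [Wu cu]; split; [exact: Wu.1|exists (q u) => //; exact: Fq].
split=> //; apply: smooth_on_ext sV => // u [Wu _].
by rewrite /= -(Fq u Wu) FK.
Qed.

Lemma is_manifold_diffeo n X Y (F : X -> Y) :
  ddiffeo F -> is_manifold n X -> is_manifold n Y.
Proof.
move=> [sF [G [sG FK GK]]] HX y; have [c hc cy] := HX (G y).
rewrite -(GK y); apply: (dchart_push hc cy sF).
- exact: can_inj FK.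
- move=> m U p pp; rewrite (_ : _ `&` _ = U); first exact: plot_open pp.
  by apply/seteqP; split=> [u []//|u Uu]; split=> //; exists (G (p u)).
- by move=> m U p pp _; exists (G \o p); [exact: sG|move=> u _; exact: GK].
Qed.

Lemma sval_injP (T : Type) (P : T -> Prop) (x y : {z | P z}) :
  sval x = sval y -> x = y.
Proof.
by case: x y => [x Px] [y Py] /= xy; move: Py; rewrite -xy => Py; congr exist;
  exact: Prop_irrelevance.
Qed.

Lemma dchart_subdiff n X (P : X -> Prop) (x0 : sub_diff P) (c : chart R n X) :
  dchart c -> cdom c (sval x0) ->
  (forall m (U : set 'rV[R]_m) p, plot U p -> open (U `&` p @^-1` P)) ->
  exists2 d : chart R n (sub_diff P), dchart d & cdom d x0.
Proof.
move=> [pc Hc] cx0 oP.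
pose G u : sub_diff P :=
  if pselect (P (cinv c u)) is left e then exist _ (cinv c u) e else x0.
have GE u : P (cinv c u) -> sval (G u) = cinv c u.
  by rewrite /G; case: pselect.
have dK (x : sub_diff P) : cdom c (sval x) -> G (cmap c (sval x)) = x.
  by move=> cx; apply: sval_injP; rewrite GE cdomK//; exact: svalP.
have imE : (fun x : sub_diff P => cmap c (sval x))
  @` [set x | cdom c (sval x)] =
    (cmap c @` cdom c) `&` cinv c @^-1` P.
  apply/seteqP; split=> [_ [x cx <-]|u [cu Pu]].
    by split; [exact: cmap_img|rewrite /preimage/= cdomK//; exact: svalP].
  by have [c1 c2] := cinv_dom cu; exists (exist P _ Pu).
have oim := oP _ _ _ pc; rewrite -imE in oim.
exists (Chart dK oim) => //; split=> /=.
  rewrite imE /plot/= /sub_plot; apply: (@plot_ext _ X _ _ (cinv c)).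
    by move=> u [_ /GE ->].
  by apply: (plot_sub pc (oP _ _ _ pc)) => u [].
by move=> m U p pp; exact: (Hc m U (fun u => sval (p u)) pp).
Qed.

(** * Plots of fibre products *)

Section FibreProducts.
Variables (X Y Z : diffspace R) (f : X -> Z) (g : Y -> Z).

Lemma plot_fst m (U : set 'rV[R]_m) (p : 'rV[R]_m -> fibprod f g) :
  plot U p -> plot U (fun u => (sval (p u)).1).
Proof. by case. Qed.

Lemma plot_snd m (U : set 'rV[R]_m) (p : 'rV[R]_m -> fibprod f g) :
  plot U p -> plot U (fun u => (sval (p u)).2).
Proof. by case. Qed.

(** The matching condition holds on [U] only, whereas parametrisations are total maps; [w0] is the
    value wherever it fails. *)
Lemma plot_fibpair m (U : set 'rV[R]_m) (p : 'rV[R]_m -> X) (q : 'rV[R]_m -> Y)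
    (w0 : fibprod f g) :
  plot U p -> plot U q -> (forall u, U u -> f (p u) = g (q u)) ->
  exists2 s : 'rV[R]_m -> fibprod f g, plot U s &
    forall u, U u -> sval (s u) = (p u, q u).
Proof.
move=> pp pq fg.
pose s u : fibprod f g :=
  if pselect (f (p u) = g (q u)) is left e then fibpair e else w0.
have sE u : U u -> sval (s u) = (p u, q u).
  by move=> Uu; rewrite /s; case: pselect => // -[]; exact: fg.
exists s => //; split.
  by apply: plot_ext pp => u Uu /=; rewrite sE.
by apply: plot_ext pq => u Uu /=; rewrite sE.
Qed.

End FibreProducts.

(** * Charts in which a submersion is a coordinate projection *)

Section Straightening.
Variables (Y Z : diffspace R) (g : Y -> Z).

Definition straight_at n k (y : Y) (c : chart R (n + k) Y) (d : chart R n Z) :=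
  [/\ dchart c, dchart d, cdom c y & forall y', cdom c y' ->
    cdom d (g y') /\ cmap d (g y') = lsubmx (cmap c y')].

(** A chart at [y] is shrunk to the domain of the normal form of [g] and composed with the
    coordinate change [th]. *)
Lemma submersion_straight (MY : manifold_structure Y)
    (MZ : manifold_structure Z) (y : Y) : submersion MY MZ g ->
  mdim MY = (mdim MZ + (mdim MY - mdim MZ))%N /\
  exists (c : chart R (mdim MZ + (mdim MY - mdim MZ)) Y)
    (d : chart R (mdim MZ) Z),
    straight_at y c d.
Proof.
move=> [sg dg]; have [c Mc cy] := charts_cover MY y.
have [d Md dgy] := charts_cover MZ (g y).
have [oV sV] := sg c d Mc Md; set V := cmap c @` _ in oV sV.
have Vy : V (cmap c y) by exists y.
have [pE [V0 [W [th [th' [[oV0 V0y V0V oW] [sth sth' thK th'K thg]]]]]]] :=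
  submersion_normal_form oV Vy sV (dg y c d Mc Md cy dgy).
split=> //.
have [pc Hc] := manifold_dchart Mc.
have V0c u : V0 u -> (cmap c @` cdom c) u by move=> /V0V[x [cx _] <-]; exists x.
pose D := [set y | cdom c y /\ V0 (cmap c y)].
have dK y' : D y' -> (cinv c \o th') ((th \o cmap c) y') = y'.
  by move=> [cy' /thK[_ /= ->]]; exact: cdomK.
have imE : (th \o cmap c) @` D = W.
  apply/seteqP; split=> [_ [x [cx /thK[Wx _]] <-]//|w Ww].
  have [V0w thw] := th'K _ Ww; have [cx xE] := cinv_dom (V0c _ V0w).
  by exists (cinv c (th' w)); [split=> //; rewrite xE|rewrite /= xE].
have oim : open ((th \o cmap c) @` D) by rewrite imE.
exists (Chart dK oim), d; split=> //=.
- split=> /=; first by rewrite imE;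
  apply: (plot_comp pc oW sth') => w /th'K[/V0c].
  move=> m U p pp; have [oU1 sU1] := Hc _ _ _ pp.
  have -> : U `&` p @^-1` D = (U `&` p @^-1` cdom c) `&` (cmap c \o p) @^-1` V0.
    by apply/seteqP; split=> [u [Uu [cu Vu]]//|u [[Uu cu] Vu]].
  have oU2 : open ((U `&` p @^-1` cdom c) `&` (cmap c \o p) @^-1` V0).
    exact: (open_preimage oU1 oV0 (fun u => smooth_on_continuous sU1)).
  split=> //; apply: (@smooth_on_comp _ _ _ _ _ V0 (cmap c \o p) th) => //.
    by move=> u [].
  by apply: smooth_on_sub sU1 => u [].
- exact: manifold_dchart.
- move=> y' [cy' Vy']; rewrite thg//= cdomK//; split=> //.
  by have [x [cx dx] /(cmap_inj cx cy') <-] := V0V _ Vy'.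
Qed.

(** In straight charts the lift takes its first n coordinates from [p] and keeps the other k frozen
    at those of [y], so it passes through [y]. *)
Lemma straight_lift n k (y : Y) (c : chart R (n + k) Y) (d : chart R n Z)
    m (U : set 'rV[R]_m) (p : 'rV[R]_m -> Z) u0 :
  straight_at y c d -> plot U p -> U u0 -> p u0 = g y ->
  exists V (q : 'rV[R]_m -> Y), [/\ open V, V u0 & V `<=` U] /\
    [/\ plot V q, (forall u, V u -> g (q u) = p u) & q u0 = y].
Proof.
move=> [[pc Hc] [pd Hd] cy Hcd] pp Uu0 pu0.
have [oU1 sU1] := Hd _ _ _ pp; set U1 := U `&` _ in oU1 sU1.
have [dgy gyE] := Hcd y cy.
pose rho u := row_mx ((cmap d \o p) u) (rsubmx (cmap c y)).
have srho : smooth_on U1 rho.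
  apply: smooth_on_row_mx => //; apply/smooth_onP => // l j.
  exact: Ck_fun_cst.
have rho0 : rho u0 = cmap c y by rewrite /rho/= pu0 gyE hsubmxK.
have oV : open (U1 `&` rho @^-1` (cmap c @` cdom c)).
  exact: (open_preimage oU1 (@cimg_open _ _ _ c)
    (fun u => smooth_on_continuous srho)).
exists (U1 `&` rho @^-1` (cmap c @` cdom c)), (cinv c \o rho); split.
  split=> //; last by move=> u [[]].
  by split; [split=> //; rewrite /preimage/= pu0|rewrite /preimage/= rho0;
    exists y].
split.
- apply: (plot_comp pc oV) => [|u []//].
  by apply: smooth_on_sub srho => u [].
- move=> u [[Uu du] ru]; have [cq qE] := cinv_dom ru.
  have [dq gq] := Hcd _ cq; apply: (cmap_inj dq du).
  by rewrite gq qE row_mxKl.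
- by rewrite /= rho0 cdomK.
Qed.

End Straightening.

(** The coordinates of (x, y) are those of x and the last k of y: the first n coordinates of y equal
    those of f x in [d], so [rho] recovers all coordinates of y. *)
Lemma fibprod_dchart nX n k (X Y Z : diffspace R) (f : X -> Z) (g : Y -> Z)
    (w0 : fibprod f g) (a : chart R nX X) (c : chart R (n + k) Y)
    (d : chart R n Z) :
  dsmooth f -> dchart a -> cdom a (sval w0).1 ->
    straight_at g (sval w0).2 c d ->
  exists2 e : chart R (nX + k) (fibprod f g), dchart e & cdom e w0.
Proof.
move=> sf [pa Ha] aw0 [[pc Hc] [pd Hd] cw0 Hcd].
pose D := [set w : fibprod f g | cdom a (sval w).1 /\ cdom c (sval w).2].
pose em (w : fibprod f g) := row_mx (cmap a (sval w).1)
  (rsubmx (cmap c (sval w).2)).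
pose x_ (u : 'rV[R]_(nX + k)) := cinv a (lsubmx u).
pose rho u := row_mx (cmap d (f (x_ u))) (rsubmx u).
pose y_ u := cinv c (rho u).
pose ei u : fibprod f g :=
  if pselect (f (x_ u) = g (y_ u)) is left e then fibpair e else w0.
have rhoE w : D w -> x_ (em w) = (sval w).1 /\ rho (em w) = cmap c (sval w).2.
  move=> [aw cw]; have xE : x_ (em w) = (sval w).1
    by rewrite /x_ row_mxKl cdomK.
  rewrite /rho xE; split=> //; rewrite (svalP w) /em row_mxKr.
  by have [_ ->] := Hcd _ cw; rewrite hsubmxK.
pose U1 : set 'rV[R]_(nX + k) := [set u | (cmap a @` cdom a) (lsubmx u)].
have oU1 : open U1.
  have := @open_preimage _ _ setT (cmap a @` cdom a)
    (fun u : 'rV[R]_(nX + k) => lsubmx u).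
  rewrite setTI; apply; [exact: openT|exact: cimg_open|move=> u _].
  by apply: (smooth_on_continuous (smooth_on_lsubmx openT)).
have px : plot U1 x_.
  by apply: (plot_comp pa oU1 (smooth_on_lsubmx oU1)).
have [oU2 sU2] := Hd _ _ _ (sf _ _ _ px); set U2 := U1 `&` _ in oU2 sU2.
have srho : smooth_on U2 rho.
  by apply: smooth_on_row_mx => //; exact: smooth_on_rsubmx.
pose U3 := U2 `&` rho @^-1` (cmap c @` cdom c).
have oU3 : open U3.
  exact: (open_preimage oU2 (@cimg_open _ _ _ c)
    (fun u => smooth_on_continuous srho)).
have eiE u : U3 u -> sval (ei u) = (x_ u, y_ u).
  move=> [[U1u du] cu]; rewrite /ei; case: pselect => // -[].
  have [cy yE] := cinv_dom cu; have [dgy gyE] := Hcd _ cy.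
  by apply: (cmap_inj du dgy); rewrite gyE yE row_mxKl.
have imE : em @` D = U3.
  apply/seteqP; split=> [_ [w Dw <-]|u U3u].
    have [xE rE] := rhoE w Dw; have [aw cw] := Dw; split; last first.
      by rewrite /preimage/= rE; exists (sval w).2.
    split; first by rewrite /U1/= row_mxKl; exists (sval w).1.
    by rewrite /preimage/= xE (svalP w); have [] := Hcd _ cw.
  have [[U1u du] cu] := U3u; have [ax xE] := cinv_dom U1u;
    have [cy yE] := cinv_dom cu.
  exists (ei u); first by rewrite /D/= eiE.
  by rewrite /em eiE//= /x_ xE yE row_mxKr hsubmxK.
have dK w : D w -> ei (em w) = w.
  move=> Dw; have U3w : U3 (em w) by rewrite -imE; exists w.
  apply: sval_injP; rewrite eiE// /y_; have [-> ->] := rhoE w Dw;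
    have [_ cw] := Dw.
  by rewrite cdomK//; case: (sval w).
have oim : open (em @` D) by rewrite imE.
exists (Chart dK oim) => //; split=> /=.
  rewrite imE; split.
    apply: (@plot_ext _ X _ _ x_) => [u /eiE /= ->//|].
    by apply: plot_sub px oU3 _ => u [[]].
  apply: (@plot_ext _ Y _ _ (cinv c \o rho)) => [u /eiE /= ->//|].
  apply: (plot_comp pc oU3) => [|u []//].
  by apply: smooth_on_sub srho => u [].
move=> m U p pp; have [oW1 sW1] := Ha _ _ _ (plot_fst pp).
have [oW2 sW2] := Hc _ _ _ (plot_snd pp).
set W1 := U `&` _ in oW1 sW1; set W2 := U `&` _ in oW2 sW2.
have -> : U `&` p @^-1` D = W1 `&` W2.
  by apply/seteqP; split=> [u [Uu [aw cw]]//|u [[Uu aw] [_ cw]]].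
have oW12 := openI oW1 oW2; split=> //.
apply: smooth_on_row_mx => //; first by apply: smooth_on_sub sW1 => u [].
apply: (@smooth_on_comp _ _ _ _ _ setT _ (fun v : 'rV_(n + k) => rsubmx v))
  => //.
- exact: openT.
- by apply: smooth_on_sub sW2 => u [].
- by apply: smooth_on_rsubmx; exact: openT.
Qed.

End DiffeologicalCharts.

(** * Principal bibundles *)

Section LocalSections.
Variable R : realType.
Implicit Types X B P N : diffspace R.

(** Stronger than the lifting in a subduction: the lift must pass through a prescribed point of the
    fibre. *)
Definition local_lifts X B (q : X -> B) : Prop :=
  forall m (U : set 'rV[R]_m) (p : 'rV[R]_m -> B) u0 x,
  plot U p -> U u0 -> p u0 = q x ->
  exists V (s : 'rV[R]_m -> X), [/\ open V, V u0 & V `<=` U] /\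
    [/\ plot V s, (forall u, V u -> q (s u) = p u) & s u0 = x].

Lemma submersion_local_lifts X B (MX : manifold_structure X)
    (MB : manifold_structure B) (q : X -> B) :
  submersion MX MB q -> local_lifts q.
Proof.
move=> sq m U p u0 x pp Uu0 pu0.
have [_ [c [d cd]]] := submersion_straight x sq.
exact: straight_lift cd pp Uu0 pu0.
Qed.

(** Lifting the inverse of a chart of [B] through [x] gives, in coordinates, a smooth local section
    [eta] of [phi]. By the chain rule its differential is a right inverse of that of [phi], which is
    therefore surjective. *)
Lemma local_lifts_submersion X B (MX : manifold_structure X)
    (MB : manifold_structure B) (q : X -> B) :
  dsmooth q -> local_lifts q -> submersion MX MB q.
Proof.
move=> sq lq; have mq := @dsmooth_mfd R X B MX MB q sq;
  split=> // x c d Mc Md cx dqx w.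
have [pd _] := manifold_dchart Md; have [_ Hc] := manifold_dchart Mc.
have [|V [s [[oV Vu0 VU] [ps qs s0]]]] :=
  lq _ _ _ (cmap d (q x)) x pd (cmap_img dqx); first by rewrite cdomK.
have [oW sW] := Hc _ _ _ ps; set W := V `&` _ in oW sW.
have Wu0 : W (cmap d (q x)) by split=> //; rewrite /preimage/= s0.
have [oV' sV'] := mq c d Mc Md; set V' := cmap c @` _ in oV' sV'.
have V'x : V' (cmap c x) by exists x.
set phi := cmap d \o q \o cinv c in sV' *; set eta := cmap c \o s in sW *.
set u0 := cmap d (q x) in Vu0 s0 Wu0 *.
have eta0 : eta u0 = cmap c x by rewrite /eta/= s0.
have [deta _] := smooth_on_diff oW sW Wu0.
have [dphi _] := smooth_on_diff oV' sV' V'x.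
have id_near : \forall u \near u0, (phi \o eta) u = id u.
  apply: (open_near_eq oW _ Wu0) => u [Vu cu].
  rewrite /phi /eta/= cdomK// qs//.
  by have [_] := cinv_dom (VU _ Vu).
exists ('d eta u0 w); rewrite -eta0 in dphi *.
have dcomp : differentiable (phi \o eta) u0 by exact: differentiable_comp.
have E := deriveE w dcomp; rewrite diff_comp//= in E.
by rewrite -E (near_eq_derive w id_near) derive_id.
Qed.

(* A section through any point is obtained by moving an arbitrary one with the
   action A, where x and w = (x, h) are sent to x h. *)
Lemma orbit_local_lifts X B P N (q : X -> B) (f : X -> N) (t : P -> N)
    (A : fibprod f t -> X) :
  dsmooth f -> dsmooth A -> local_lifts t -> subduction q ->
  (forall w, q (A w) = q (sval w).1) ->
  (forall x x', q x = q x' -> exists2 w : fibprod f t, (sval w).1 = x &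
    A w = x') ->
  local_lifts q.
Proof.
move=> sf sA lt [_ _ subq] qA trA m U p u0 x pp Uu0 pu0.
have [C [oC UC lC]] := subq _ _ _ pp.
have [V CV Vu0] : (\bigcup_(V in C) V) u0 by rewrite -UC.
have VU : V `<=` U by rewrite UC => u Vu; exists V.
have [s ps qs] := lC V CV.
have [w w1 Aw] : exists2 w : fibprod f t, (sval w).1 = s u0 & A w = x.
  by apply: trA; rewrite -qs.
have tw : f (s u0) = t (sval w).2 by rewrite -w1; exact: (svalP w).
have [V' [h [[oV' V'u0 V'V] [ph th h0]]]] := lt _ _ _ _ _ (sf _ _ _ ps) Vu0 tw.
have [z pz zE] := plot_fibpair w (plot_sub ps oV' V'V) ph
  (fun u Vu => esym (th u Vu)).
exists V', (A \o z); split; first by split=> //; exact: subset_trans VU.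
split; first exact: sA.
  by move=> u Vu; rewrite /= qA zE//= -qs//; exact: V'V.
by rewrite /= -Aw; congr A; apply: sval_injP; rewrite zE// h0 -w1;
  case: (sval w).
Qed.

Definition fibswap X B N (f : X -> N) (g : B -> N) (w : fibprod f g) :
  fibprod g f :=
  fibpair (esym (svalP w)).

Lemma fibswap_smooth X B N (f : X -> N) (g : B -> N) :
  dsmooth (@fibswap X B N f g).
Proof. by move=> m U p [p1 p2]; split. Qed.

Lemma fibswap_diffeo X B N (f : X -> N) (g : B -> N) :
  ddiffeo (@fibswap X B N f g).
Proof.
split; first exact: fibswap_smooth.
exists (@fibswap B X N g f); split; first exact: fibswap_smooth.
  by move=> w; apply: sval_injP => /=; case: (sval w).
by move=> w; apply: sval_injP => /=; case: (sval w).
Qed.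

Lemma is_manifold_fibprod n X P N (f : X -> N) (t : P -> N)
    (MP : manifold_structure P) (MN : manifold_structure N) :
  is_manifold n X -> dsmooth f -> submersion MP MN t ->
  is_manifold (n + (mdim MP - mdim MN)) (fibprod f t).
Proof.
move=> HX sf st w; have [a ha ax] := HX (sval w).1.
have [_ [c [d cd]]] := submersion_straight (sval w).2 st.
exact: fibprod_dchart sf ha ax cd.
Qed.

End LocalSections.

(** * Anchors and total space of a principal bibundle *)

Section Principal.
Variables (R : realType) (G H : lie_groupoid R) (X : bibundle G H).
Local Notation l := (@anchl R G H X).
Local Notation r := (@anchr R G H X).
Local Notation t := (@tgt R H).
Local Notation s := (@src R G).

Lemma anchl_smooth : dsmooth l. Proof. exact: lanchor_smooth. Qed.
Lemma anchr_smooth : dsmooth r. Proof. exact: ranchor_smooth. Qed.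

Lemma ract_fun_smooth : dsmooth (@ract_fun R G H X).
Proof. exact: ract_smooth. Qed.

Lemma lact_fun_smooth : dsmooth (@lact_fun R G H X).
Proof. exact: lact_smooth. Qed.

Lemma ract_pairE (w : ract_dom X) :
  sval (ract_pair w) = ((sval w).1, ract_fun w).
Proof. by []. Qed.

Lemma lact_pairE (w : lact_dom X) :
  sval (lact_pair w) = (lact_fun w, (sval w).2).
Proof. by []. Qed.

Lemma anchl_ract (w : ract_dom X) : l (ract_fun w) = l (sval w).1.
Proof. exact: lanchor_inv. Qed.

Lemma anchr_lact (w : lact_dom X) : r (lact_fun w) = r (sval w).2.
Proof. exact: ranchor_inv. Qed.

(** The inverse [D] of [ract_pair] is a division map: it sends (x, x') in a common fibre of [l] to
    (x, h) with x h = x', the transitivity that [orbit_local_lifts] asks for. *)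
Lemma right_principal_local_lifts : right_principal X -> local_lifts l.
Proof.
move=> [subl [_ [D [_ _ DK]]]].
apply: (orbit_local_lifts anchr_smooth ract_fun_smooth
  (submersion_local_lifts (tgt_submersion H)) subl anchl_ract) => x x' e.
have := ract_pairE (D (fibpair e)); rewrite DK => -[e1 e2].
by exists (D (fibpair e)).
Qed.

(** The mirror image, with the factors of the action exchanged to fit [orbit_local_lifts]. As
    [lact_pair] lists the moved point first, division is applied to (x', x). *)
Lemma left_principal_local_lifts : left_principal X -> local_lifts r.
Proof.
move=> [subr [_ [D [_ _ DK]]]].
pose A (w : fibprod l s) := lact_fun (fibswap w : lact_dom X).
have sA : dsmooth A := dsmooth_comp (@fibswap_smooth _ _ _ _ _ _)
  lact_fun_smooth.
have rA w : r (A w) = r (sval w).1 by rewrite anchr_lact.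
apply: (orbit_local_lifts anchl_smooth sA
  (submersion_local_lifts (src_submersion G)) subr rA) => x x' e.
have := lact_pairE (D (fibpair (esym e))); rewrite DK => -[e1 e2].
exists (fibswap (D (fibpair (esym e)))); first exact: esym e2.
apply: etrans (esym e1); congr lact_fun; apply: sval_injP => /=.
by case: (sval _).
Qed.

(* Near x0, a local section sig of l over {y | P y} identifies l^-1(P) with the
   fibre product of r \o sig and t. *)
Lemma right_principal_manifold : right_principal X ->
  is_manifold (mdim (obj_mfd G) + (mdim (arr_mfd H) - mdim (obj_mfd H))) X.
Proof.
move=> rp x0; have [_ [_ [D [smD Dl DK]]]] := rp.
have [c Mc cx0] := charts_cover (obj_mfd G) (l x0).
have [pc Hc] := manifold_dchart Mc.
(* The plot [cinv c] is lifted along [l], so [sg] is a section written in the coordinates of [c];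
   [sig] is the same section on the subset [P] of the objects. *)
have [|V [sg [[oV Vu0 VU] [psg lsg sg0]]]] :=
  right_principal_local_lifts rp pc (cmap_img cx0) (x := x0);
    first by rewrite cdomK.
pose P y := cdom c y /\ V (cmap c y).
have oP m (U : set 'rV[R]_m) p : plot U p -> open (U `&` p @^-1` P).
  move=> pp; have [oW sW] := Hc _ _ _ pp.
  rewrite (_ : _ `&` _ = (U `&` p @^-1` cdom c) `&` (cmap c \o p) @^-1` V).
    exact: (open_preimage oW oV (fun u => smooth_on_continuous sW)).
  by apply/seteqP; split=> [u [Uu [cu Vu]]//|u [[Uu cu] Vu]].
pose sig (y : sub_diff P) := sg (cmap c (sval y)).
have lsig y : l (sig y) = sval y.
  by rewrite /sig; have [cy Vy] := svalP y; rewrite lsg//= cdomK.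
have ssig : dsmooth sig.
  move=> m U p pp; have [_ sW] := Hc _ _ _ (pp : plot U (fun u => sval (p u))).
  apply: (plot_comp psg (plot_open pp) _) => [|u _];
    last by have [] := svalP (p u).
  by apply: smooth_on_sub sW => u Uu; split=> //; have [] := svalP (p u).
have Px0 : P (l x0) by [].
pose y0 : sub_diff P := exist P (l x0) Px0.
have sf : dsmooth (r \o sig) := dsmooth_comp ssig anchr_smooth.
pose emb (w : fibprod (r \o sig) t) : ract_dom X :=
  @fibpair R _ _ _ r t (sig (sval w).1) (sval w).2 (svalP w).
pose F w := ract_fun (emb w).
have semb : dsmooth emb by move=> m U p [p1 p2]; split=> //;
  exact: (ssig _ _ _ p1).
have sF : dsmooth F := dsmooth_comp semb ract_fun_smooth.
have lF w : l (F w) = sval (sval w).1 by rewrite anchl_ract lsig.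
(* The anchor [l] recovers the base point, and the left inverse [D] of [ract_pair], expressing
   freeness of the action, then recovers the arrow. *)
have iF : injective F.
  move=> w w' Fww'.
  have e1 : (sval w).1 = (sval w').1 by apply: sval_injP; rewrite -!lF Fww'.
  have : emb w = emb w'.
    apply: (can_inj Dl); apply: sval_injP; rewrite !ract_pairE.
    by rewrite -/(F w) -/(F w') Fww' /= e1.
  move=> /(congr1 (fun z => (sval z).2)) /= e2; apply: sval_injP.
  by move: e1 e2; case: (sval w) => a b; case: (sval w') => a' b' /= -> ->.
have liftF x y (w : ract_dom X) : sval (ract_pair w) = (sig y, x) ->
    exists2 w' : fibprod (r \o sig) t, sval w' = (y, (sval w).2) & F w' = x.
  rewrite ract_pairE => -[w1 w2].
  have e : (r \o sig) y = t (sval w).2 by rewrite /= -w1; exact: (svalP w).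
  exists (@fibpair R _ _ _ (r \o sig) t _ _ e) => //; rewrite -[RHS]w2 /F.
  by congr ract_fun; apply: sval_injP => /=; rewrite -w1; case: (sval w).
(* The range is all of l^-1(P), since [D] divides any such x by the value of the section over l x;
   this makes the range D-open. *)
have rgF x : range F x <-> P (l x).
  split=> [[w _ <-]|Px]; first by rewrite lF; exact: svalP.
  have e : l (sig (exist P (l x) Px)) = l x by rewrite lsig.
  have [|w' _ <-] := @liftF x (exist P (l x) Px) (D (fibpair e));
    last by exists w'.
  by rewrite DK.
have [w0 _ Fw0] : range F x0 by apply/rgF.
rewrite -Fw0.
have [a ha aw0] : exists2 a : chart R (mdim (obj_mfd G)) (sub_diff P),
    dchart a & cdom a (sval w0).1.
  apply: (dchart_subdiff (manifold_dchart Mc)) => //.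
  by have [] := svalP (sval w0).1.
have [_ [c' [d cd]]] := submersion_straight (sval w0).2 (tgt_submersion H).
have [e he ew0] := fibprod_dchart sf ha aw0 cd.
apply: (dchart_push he ew0 sF iF) => m U p pp.
  rewrite (_ : _ `&` _ = U `&` (l \o p) @^-1` P);
    first exact: oP (anchl_smooth pp).
  by apply/seteqP; split=> u [Uu /rgF].
(* A plot [p] in the range lifts with base component l p and, as arrow component, the quotient of
   [p] by the section over l p; smoothness of [D] makes the latter a plot. *)
move=> rp_.
pose y u : sub_diff P :=
  if pselect (P (l (p u))) is left e then exist P _ e else y0.
have yE u : U u -> sval (y u) = l (p u).
  by move=> /rp_/rgF Pu; rewrite /y; case: pselect.
have py : plot U y.
  apply: (@plot_ext _ (obj G) _ _ (l \o p)) => [u Uu|];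
    last exact: anchl_smooth.
  by rewrite yE.
have lyp u : U u -> l (sig (y u)) = l (p u) by move=> Uu; rewrite lsig yE.
have [z pz zE] := plot_fibpair (fibpair (erefl (l x0))) (ssig _ _ _ py) pp lyp.
have E u : U u -> exists2 w' : fibprod (r \o sig) t,
    sval w' = (y u, (sval (D (z u))).2) & F w' = p u.
  by move=> Uu; apply: liftF; rewrite DK zE.
have yz u : U u -> (r \o sig) (y u) = t (sval (D (z u))).2.
  by move=> /E[w' w'E _]; have := svalP w'; rewrite w'E.
have [q pq qE] := plot_fibpair w0 py (plot_snd (smD _ _ _ pz)) yz.
exists q => // u Uu; have [w' w'E <-] := E u Uu.
by congr F; apply: sval_injP; rewrite qE.
Qed.

End Principal.

Theorem corollary6p9 (R : realType) (G H : lie_groupoid R) (X : bibundle G H) :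
  biprincipal X -> lie_biprincipal X.
Proof.
move=> [lp rp].
have HX := right_principal_manifold rp.
have sl := @anchl_smooth R G H X; have sr := @anchr_smooth R G H X.
have HXH := is_manifold_fibprod HX sr (tgt_submersion H).
(* The fibre product charts need the submersion on the right factor, while [lact_dom] has the arrows
   on the left; hence the swap. *)
have HGX := is_manifold_diffeo (fibswap_diffeo _ _)
  (is_manifold_fibprod HX sl (src_submersion G)).
have [_ dr] := rp; have [_ dl] := lp.
have [MX _] := is_manifold_structure HX.
have [MGX _] := is_manifold_structure HGX.
have [MXH _] := is_manifold_structure HXH.
have [MXlX _] := is_manifold_structure (is_manifold_diffeo dr HXH).
have [MXrX _] := is_manifold_structure (is_manifold_diffeo dl HGX).
have [[[_ surl _] _] [[_ surr _] _]] := (rp, lp).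
exists MX, MGX, MXH, MXlX, MXrX; split.
- split=> //; apply: local_lifts_submersion sl _.
  exact: right_principal_local_lifts.
- split=> //; apply: local_lifts_submersion sr _.
  exact: left_principal_local_lifts.
- split; apply: dsmooth_mfd; first exact: lact_fun_smooth.
  exact: ract_fun_smooth.
- exact: ddiffeo_mfd.
- exact: ddiffeo_mfd.
Qed.
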